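(* For each of the following pairs of bases $(\beta,\gamma)$, the point mass $\delta_0$ is the only Borel probability measure $\mu$ on $X$ with $(T_\beta)_*\mu=(T_\gamma)_*\mu=\mu$: \begin{enumerate} \item $\beta>1$ irrational and $\gamma=k\beta+c$, where $k\ge 2$ is an integer and $c\in\mathbb Q$ with $c\ge 0$; \item $\beta>1$ irrational and $\gamma>1$ rational. \end{enumerate}
   Context: $X=[0,1)$. For a real number $b>1$, the beta-transformation $T_b:X\to X$ is $T_b(x)=bx-\lfloor bx\rfloor$. For a Borel map $F:X\to X$, $F_*\mu$ denotes the pushforward, $F_*\mu(E)=\mu(F^{-1}E)$. $\delta_0$ is the unit point mass at $0$. *)

(* Defs.v *)
From HB Require Import structures.
From mathcomp Require Import all_boot all_order all_algebra.
From mathcomp Require Import all_classical all_reals all_analysis.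
Set Implicit Arguments.
Unset Strict Implicit.
Unset Printing Implicit Defensive.
Import Order.TTheory GRing.Theory Num.Theory.
Import numFieldNormedType.Exports.
Local Open Scope classical_set_scope.
Local Open Scope ring_scope.

Definition unit_ico (R : realType) : Type := set_type ([set` `[0, 1[] : set R).

Section unit_ico.
Context {R : realType}.

(* the subspace topology, inherited from [set_type] *)
HB.instance Definition _ := Topological.on (unit_ico R).

Lemma zero_in_ico : (0 : R) \in ([set` `[0, 1[] : set R).
Proof. by apply: mem_set; rewrite /= in_itv /= lexx ltr01. Qed.

Definition ico0 : unit_ico R := SigSub zero_in_ico.

HB.instance Definition _ := isPointed.Build (unit_ico R) ico0.

Lemma frac_in_ico (y : R) :
  y - (Num.floor y)%:~R \in ([set` `[0, 1[] : set R).
Proof.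
apply: mem_set; rewrite /= in_itv /= subr_ge0 floor_le /=.
by rewrite ltrBlDr addrC -intrD1 floorD1_gt.
Qed.

End unit_ico.
Arguments ico0 : clear implicits.

Definition borel_ico (R : realType) := g_sigma_algebraType (@open (unit_ico R)).

Definition beta_transform (R : realType) (b : R) (x : borel_ico R) :
    borel_ico R :=
  SigSub (frac_in_ico (b * val x)).

(* Set functions are compared on Borel sets only: a [probability] is a function
   on all sets, unconstrained outside the sigma-algebra. *)
Definition measure_eq d (T : measurableType d) (R : realType)
    (mu nu : set T -> \bar R) : Prop :=
  forall E, measurable E -> mu E = nu E.

Definition invariant_measure d (T : measurableType d) (R : realType)
    (mu : set T -> \bar R) (F : T -> T) : Prop :=
  measure_eq (pushforward mu F) mu.

Definition dirac0_only_common_invariant (R : realType) (b g : R) : Prop :=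
  forall mu : probability (borel_ico R) R,
    (invariant_measure mu (beta_transform b) /\
     invariant_measure mu (beta_transform g)) <->
    measure_eq mu (\d_(ico0 R : borel_ico R)).

(* Main.v *)
(** Write both cases as [gamma = k beta + c] with [k >= 0] an integer, [c >= 0]
    rational and [k + c > 1] (the second case is [k = 0], [c = gamma]), and let
    [q] be a positive integer such that [q c] is an integer.

    A common invariant measure [mu] is preserved by [T_gamma T_beta] and by
    [T_beta T_gamma]. Multiplied by [q], these maps send [x] mod 1 to
    [q beta gamma x - da th] and [q beta gamma x - db th], where [th = q beta] is
    irrational, [da = k floor(beta x)] and [db = floor(gamma x) >= da]. Equality
    of the two distributions says that the sum over [da <= i < db] of the
    distributions of [q beta gamma x - i th] is invariant under rotation by [th],
    hence a multiple of Lebesgue measure. So [mu] is absolutely continuous on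
    [da < db]. Where [da = db] one has [T_gamma x = k T_beta x + c x] exactly, and
    integrating this identity over an invariant null set shows that [mu] is
    absolutely continuous off [0].

    The absolutely continuous part is then a multiple of Parry's measure, of
    density [\sum_n b^-n 1_[0, T^n 1)], for [b = beta] and for [b = gamma]; this
    uses ergodicity of [T_b], and the Hahn decomposition of the difference. The
    two Parry densities are not proportional: if [gamma > beta + 1], they have
    different ratios of their values at [0] and at [1]; if [gamma] is rational,
    only that of [beta] jumps at the fractional part of [beta]. *)

From HB Require Import structures.
Require Import Defs.
From mathcomp Require Import all_boot all_order all_algebra.
From mathcomp Require Import all_classical all_reals all_analysis.
From mathcomp Require Import measurable_realfun zify ring lra.
Import Order.TTheory GRing.Theory Num.Theory.
Import numFieldNormedType.Exports.
Set Implicit Arguments.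
Unset Strict Implicit.
Unset Printing Implicit Defensive.
Local Open Scope classical_set_scope.
Local Open Scope ring_scope.

(** * Fractional parts and the beta-map on the real line *)

Section fpart.
Context {R : realType}.
Implicit Types x y b : R.

Definition fpart x : R := x - (Num.floor x)%:~R.

Lemma fpart_ge0 x : 0 <= fpart x.
Proof. by rewrite subr_ge0 floor_le. Qed.

Lemma fpart_lt1 x : fpart x < 1.
Proof. by rewrite ltrBlDl -intrD1 floorD1_gt. Qed.

Lemma fpart_itv x : 0 <= fpart x < 1.
Proof. by rewrite fpart_ge0 fpart_lt1. Qed.

Lemma floor_fpart x : (Num.floor x)%:~R = x - fpart x.
Proof. by rewrite /fpart opprB addrC subrK. Qed.

Lemma fpartDz x (z : int) : fpart (x + z%:~R) = fpart x.
Proof.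
by rewrite /fpart floorDrz ?intrKfloor ?intr_int// intrD opprD addrACA subrr addr0.
Qed.

Lemma fpart_eq x y (z : int) : x = y + z%:~R -> fpart x = fpart y.
Proof. by move=> ->; exact: fpartDz. Qed.

Lemma fpart_id x : 0 <= x < 1 -> fpart x = x.
Proof. by move=> x01; rewrite /fpart (@floor_def _ _ 0) ?subr0// add0r. Qed.

Lemma fpart_truncn x : 0 <= x -> fpart x = x - (Num.truncn x)%:R.
Proof.
move=> x0; rewrite /fpart truncn_floor x0 natr_absz ger0_norm//.
by rewrite floor_ge0.
Qed.

(** Taken on all of [R], so that Lebesgue measure on the line applies directly and Parry's orbit can
    start at [1], outside [[0, 1)]. *)
Definition beta_map b x : R := fpart (b * x).

Lemma beta_map_itv b x : 0 <= beta_map b x < 1.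
Proof. exact: fpart_itv. Qed.

Lemma rational_beta_map b x : rational b -> rational x -> rational (beta_map b x).
Proof.
case=> p _ <-; case=> r _ <-; exists (p * r - (Num.floor (ratr (p * r) : R))%:~R) => //.
have -> : ratr (p * r) = ratr p * ratr r :> R by rewrite rmorphM.
by rewrite /beta_map /fpart rmorphB rmorph_int rmorphM.
Qed.

Lemma rational_div (p q : int) : rational (p%:~R / q%:~R : R).
Proof. by exists (p%:~R / q%:~R) => //; rewrite fmorph_div !rmorph_int. Qed.

Lemma fpart_gt0 x : irrational x -> 0 < fpart x.
Proof.
move=> irr; rewrite lt_def fpart_ge0 andbT; apply/negP => /eqP/eqP.
rewrite subr_eq0 => /eqP xE; apply: irr; exists (Num.floor x)%:~R => //.
by rewrite ratr_int.
Qed.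

End fpart.

(** * Subgroups of the reals containing an irrational number *)

Section small_elements.
Context {R : realType}.
Variables (H : R -> Prop) (th : R).
Hypotheses (H1 : H 1) (Hth : H th) (irr : irrational th).
Hypothesis (HB : forall x y, H x -> H y -> H (x - y)).

Lemma subgroup_int x (z : int) : H x -> H (z%:~R * x).
Proof.
move=> Hx.
have H0 : H 0 by rewrite -(subrr x); exact: HB.
have HN y : H y -> H (- y) by rewrite -(sub0r y); exact: HB.
have Hn (n : nat) : H (n%:~R * x).
  elim: n => [|n IH]; first by rewrite mul0r.
  rewrite -addn1 PoszD intrD mulrDl mul1r -[X in _ + X]opprK.
  by apply: HB => //; exact: HN.
by case: z => n //; rewrite NegzE intrN mulNr; exact/HN/Hn.
Qed.

(* One of [1], [th] is not a multiple of [h]; its remainder mod [h], or the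
   complement of that remainder, is at most [h / 2]. *)
Lemma subgroup_halve h : H h -> 0 < h -> exists2 h', H h' & 0 < h' <= h / 2.
Proof.
move=> Hh h0.
have [g Hg nz] : exists2 g, H g & fpart (g / h) != 0.
  have [f1|f1] := eqVneq (fpart (1 / h)) 0; last by exists 1.
  have [fth|fth] := eqVneq (fpart (th / h)) 0; last by exists th.
  exfalso; apply: irr.
  have -> : th = (Num.floor (th / h))%:~R / (Num.floor (1 / h))%:~R.
    by rewrite !floor_fpart f1 fth !subr0; field; rewrite gt_eqF.
  exact: rational_div.
pose r := fpart (g / h) * h.
have rE : r = g - (Num.floor (g / h))%:~R * h.
  by rewrite /r /fpart; field; rewrite gt_eqF.
have Hr : H r by rewrite rE; apply: HB => //; exact: subgroup_int.
have r0 : 0 < r by rewrite mulr_gt0// lt_def nz fpart_ge0.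
have rh : r < h by rewrite -[ltRHS]mul1r ltr_pM2r// fpart_lt1.
have [rle|rgt] := leP r (h / 2); first by exists r => //; rewrite r0.
by exists (h - r); [exact: HB | apply/andP; split; lra].
Qed.

Lemma subgroup_small e : 0 < e -> exists2 h, H h & 0 < h < e.
Proof.
move=> e0.
have Hn (n : nat) : exists2 h, H h & 0 < h <= 2^-1 ^+ n.
  elim: n => [|n [h Hh /andP[h0 hn]]]; first by exists 1 => //; rewrite ltr01/=.
  have [h' Hh' /andP[h'0 h'h]] := subgroup_halve Hh h0.
  exists h' => //; rewrite h'0 (le_trans h'h)// exprS mulrC.
  by rewrite ler_pM2l// invr_gt0.
have [n ne] : exists n, 2^-1 ^+ n < e.
  have : 2^-1 ^+ n @[n --> \oo] --> (0 : R).
    by apply: cvg_expr; rewrite ger0_norm ?invr_ge0//; lra.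
  move/cvgr0_norm_lt => /(_ _ e0)[n _ /(_ n (leqnn n))] /=.
  by rewrite ger0_norm ?exprn_ge0 ?invr_ge0//; exists n.
have [h Hh /andP[h0 hn]] := Hn n.
by exists h => //; rewrite h0 (le_lt_trans hn ne).
Qed.

End small_elements.

(* A monotone function which is affine along arbitrarily small steps is affine. *)
Lemma monotone_quasiaffine {R : realType} (K : R -> R) (c th : R) :
  irrational th -> {homo K : x y / x <= y} -> 0 <= c ->
  (forall t, K (t + 1) = K t + c) -> (forall t, K (t + th) = K t + c * th) ->
  forall u v, u <= v -> K v - K u <= c * (v - u).
Proof.
move=> irr Kmono c0 K1 Kth u v uv.
(* The steps along which [K] is affine with slope [c] form a subgroup; it contains [1] and the
   irrational [th], hence arbitrarily small positive numbers. *)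
pose H d := forall t, K (t + d) = K t + c * d.
have H1 : H 1 by move=> t; rewrite mulr1.
have HB x y : H x -> H y -> H (x - y).
  move=> Hx Hy t; have := Hy (t + (x - y)); rewrite addrA subrK => e.
  have := Hx t; lra.
apply/ler_addgt0Pr => e e0.
(* Dividing by [c + 1] rather than [c] covers the case [c = 0] and still gives [c * h <= e]. *)
have e0' : 0 < e / (c + 1) by rewrite divr_gt0//; lra.
have [h Hh /andP[h0 he]] := @subgroup_small R H th H1 Kth irr HB _ e0'.
(* [m * h] is the first multiple of [h] beyond [v - u], so it overshoots by at most [h], and
   monotonicity bounds [K v] by [K (u + m * h)]. *)
have := @subgroup_int R H HB h (Num.floor ((v - u) / h) + 1) Hh u.
set m := _%:~R => Km.
have m1 : v - u <= m * h.
  by rewrite -ler_pdivrMr// ltW// /m floorD1_gt.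
have m2 : m * h <= v - u + h.
  rewrite /m intrD1 mulrDl mul1r lerD2r -ler_pdivlMr// floor_le//.
have : K v <= K (u + m * h) by apply: Kmono; lra.
rewrite Km => KvM.
have ch : c * h <= e.
  rewrite (@le_trans _ _ (c * (e / (c + 1))))//; first by rewrite ler_wpM2l// ltW.
  rewrite mulrA ler_pdivrMr; last by lra.
  by rewrite mulrDr mulr1 mulrC lerDl ltW.
have := ler_wpM2l c0 m2; rewrite mulrDr => ?; lra.
Qed.

(** * Bounded measurable functions and measure-preserving maps *)

Section bounded_measurable.
Context d (X : measurableType d) {R : realType}.
Variable mu : {finite_measure set X -> \bar R}.
Implicit Types f g : X -> R.

Definition bounded_measurable f :=
  measurable_fun setT f /\ exists M, forall x, `|f x| <= M.

Lemma bounded_measurable_integrable f :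
  bounded_measurable f -> mu.-integrable setT (EFin \o f).
Proof.
move=> [mf [M Mf]]; apply: measurable_bounded_integrable => //.
  exact: fin_num_fun_lty.
exists M; split => [|N MN x _ /=]; first exact: num_real.
exact/(le_trans (Mf x))/ltW.
Qed.

Lemma bounded_measurable_cst (r : R) : bounded_measurable (fun=> r).
Proof. by split; [exact: measurable_cst | exists `|r|]. Qed.

Lemma bounded_measurableD f g : bounded_measurable f -> bounded_measurable g ->
  bounded_measurable (fun x => f x + g x).
Proof.
move=> [mf [M Mf]] [mg [N Ng]]; split; first exact: measurable_funD.
by exists (M + N) => x; rewrite (le_trans (ler_normD _ _))// lerD.
Qed.

Lemma bounded_measurableZ (r : R) f : bounded_measurable f ->
  bounded_measurable (fun x => r * f x).
Proof.
move=> [mf [M Mf]]; split; first by apply: measurable_funM.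
by exists (`|r| * M) => x; rewrite normrM ler_wpM2l.
Qed.

Lemma bounded_measurableB f g : bounded_measurable f -> bounded_measurable g ->
  bounded_measurable (fun x => f x - g x).
Proof.
move=> bf bg; under eq_fun do rewrite -mulN1r.
by apply: bounded_measurableD => //; exact: bounded_measurableZ.
Qed.

Lemma bounded_measurable_if (P : X -> bool) f :
  measurable_fun setT P -> bounded_measurable f ->
  bounded_measurable (fun x => if P x then f x else 0).
Proof.
move=> mP [mf [M Mf]]; split; first exact: measurable_fun_ifT.
exists M => x; case: ifP => // _.
by rewrite normr0 (le_trans _ (Mf x)).
Qed.

Lemma bounded_measurable_sum (f : nat -> X -> R) (n : nat) :
  (forall i, bounded_measurable (f i)) ->
  bounded_measurable (fun x => \sum_(0 <= i < n) f i x).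
Proof.
move=> bf; elim: n => [|n IH].
  under eq_fun do rewrite big_geq//; exact: bounded_measurable_cst.
under eq_fun do rewrite big_nat_recr//=.
exact: bounded_measurableD.
Qed.

Lemma measurable_floor : measurable_fun [set: R] (fun x : R => (Num.floor x)%:~R : R).
Proof.
by apply: nondecreasing_measurable => // x y xy; rewrite ler_int le_floor.
Qed.

Lemma measurable_fpart : measurable_fun [set: R] (@fpart R).
Proof. by apply: measurable_funB => //; exact: measurable_floor. Qed.

Lemma bounded_measurable_fpart f : measurable_fun setT f ->
  bounded_measurable (fun x => fpart (f x)).
Proof.
move=> mf; split; first exact: (measurableT_comp measurable_fpart).
by exists 1 => x; rewrite ger0_norm ?fpart_ge0// ltW// fpart_lt1.
Qed.

Lemma bounded_measurable_floor f : bounded_measurable f ->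
  bounded_measurable (fun x => (Num.floor (f x))%:~R).
Proof.
move=> bf; under eq_fun do rewrite floor_fpart.
by apply: bounded_measurableB => //; apply: bounded_measurable_fpart; case: bf.
Qed.

Lemma bounded_measurable_comp (T : X -> X) f : measurable_fun setT T ->
  bounded_measurable f -> bounded_measurable (fun x => f (T x)).
Proof.
move=> mT [mf [M Mf]]; split; last by exists M => x.
exact: (measurableT_comp mf mT).
Qed.

Definition preserves (T : X -> X) :=
  measurable_fun setT T /\ forall E, measurable E -> mu (T @^-1` E) = mu E.

Lemma preserves_Rintegral T f : preserves T -> bounded_measurable f ->
  \int[mu]_x f (T x) = \int[mu]_x f x.
Proof.
move=> [mT muT] bf; rewrite /Rintegral; congr fine.
have bfT : bounded_measurable (f \o T).
  exact: bounded_measurable_comp.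
rewrite -(@integral_pushforward _ _ _ _ _ T mT mu setT (EFin \o f)) => //.
- apply: eq_measure_integral => // A mA _; exact: muT.
- by apply/measurable_EFinP; case: bf.
- exact: (bounded_measurable_integrable bfT).
Qed.

End bounded_measurable.

(** The range [M] is fixed and the true bounds enter through the condition, because [a] and [b] will
    depend on the point of integration: the sum is then a finite sum of measurable functions. *)
Lemma telescope_if (R : zmodType) (f : nat -> R) (a b M : nat) :
  (a <= b)%N -> (b <= M)%N ->
  \sum_(0 <= i < M) (if (a <= i < b)%N then f i.+1 - f i else 0) = f b - f a.
Proof.
move=> ab bM; rewrite -(telescope_sumr f ab) (@big_cat_nat _ _ _ b)//=.
rewrite [X in _ + X]big_nat_cond [X in _ + X]big1 ?addr0; last first.
  by move=> i /andP[/andP[bi _] _]; rewrite (ltnNge i) bi andbF.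
rewrite (@big_cat_nat _ _ _ a)//= [X in X + _]big_nat_cond [X in X + _]big1 ?add0r.
  by apply: eq_big_nat => i ->.
by move=> i /andP[/andP[_ ia] _]; rewrite (leqNgt a) ia.
Qed.

(** * Absolute continuity of common invariant measures *)

Section commutation.
Context d (X : measurableType d) {R : realType}.
Variable mu : {finite_measure set X -> \bar R}.
Variables (v : X -> R) (B G : X -> X) (b g : R) (k p q : nat).
Hypotheses (mv : measurable_fun setT v) (v01 : forall x, 0 <= v x < 1).
Hypotheses (Bmu : preserves mu B) (Gmu : preserves mu G).
Hypotheses (vB : forall x, v (B x) = beta_map b (v x)).
Hypotheses (vG : forall x, v (G x) = beta_map g (v x)).
Hypotheses (b1 : 1 < b) (irr : irrational b) (g1 : 1 < g) (q0 : (0 < q)%N).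
Hypothesis gE : g = k%:R * b + p%:R / q%:R.

Let da x := (k * Num.truncn (b * v x))%N.
Let db x := Num.truncn (g * v x).
Let th := q%:R * b.
Let s := q%:R * b * g.
Let M := Num.truncn g.

Let b_gt0 : 0 < b. Proof. exact: lt_trans b1. Qed.
Let g_gt0 : 0 < g. Proof. exact: lt_trans g1. Qed.

Let bv_ge0 x : 0 <= b * v x.
Proof. by rewrite mulr_ge0 ?(ltW b_gt0)//; case/andP: (v01 x). Qed.

Let gv_ge0 x : 0 <= g * v x.
Proof. by rewrite mulr_ge0 ?(ltW g_gt0)//; case/andP: (v01 x). Qed.

Let da_le_db x : (da x <= db x)%N.
Proof.
rewrite truncn_ge_nat// gE mulrDl natrM -mulrA -[leLHS]addr0 lerD//.
  by rewrite ler_wpM2l// truncn_le.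
by apply: mulr_ge0; [exact: divr_ge0 | case/andP: (v01 x)].
Qed.

Let db_le_M x : (db x <= M)%N.
Proof.
by apply: le_truncn; rewrite ger_pMr// ltW//; case/andP: (v01 x).
Qed.

Let irr_th : irrational th.
Proof.
case=> r _ rE; apply: irr; exists (r / q%:R) => //.
have -> : ratr (r / q%:R) = ratr r / q%:R :> R by rewrite fmorph_div rmorph_nat.
by rewrite rE /th mulrC mulKf// pnatr_eq0 -lt0n.
Qed.

Let vBE x : v (B x) = b * v x - (Num.truncn (b * v x))%:R.
Proof. by rewrite vB /beta_map fpart_truncn. Qed.

Let vGE x : v (G x) = g * v x - (Num.truncn (g * v x))%:R.
Proof. by rewrite vG /beta_map fpart_truncn. Qed.

(** As a function of [t], this staircase jumps by one at every lift of the point [s * v x - i * th]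
    mod 1: it is the distribution function of that point mass on the circle, unrolled to the
    line. *)
Let F t (i : nat) x : R := (Num.floor (t - s * v x + i%:R * th))%:~R.

Let S t x := \sum_(0 <= i < M) (if (da x <= i < db x)%N then F t i x else 0).
Let C x : R := (db x)%:R - (da x)%:R.

Let bmv : bounded_measurable v.
Proof.
split=> //; exists 1 => x.
by case/andP: (v01 x) => ? ?; rewrite ger0_norm// ltW.
Qed.

Let bm_truncn (c : R) : 0 < c ->
  bounded_measurable (fun x => (Num.truncn (c * v x))%:R : R).
Proof.
move=> c0.
have bf : bounded_measurable (fun x => (Num.floor (c * v x))%:~R : R).
  exact/bounded_measurable_floor/bounded_measurableZ.
congr bounded_measurable: bf; apply/funext => x.
have cv0 : 0 <= c * v x by rewrite mulr_ge0 ?(ltW c0)//; case/andP: (v01 x).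
by rewrite truncn_floor cv0 natr_absz ger0_norm// floor_ge0.
Qed.

Let bm_da : bounded_measurable (fun x => (da x)%:R : R).
Proof.
under eq_fun do rewrite natrM.
by apply: bounded_measurableZ; exact: bm_truncn.
Qed.

Let bm_db : bounded_measurable (fun x => (db x)%:R : R).
Proof. exact: bm_truncn. Qed.

Let measurable_between i : measurable_fun setT (fun x => (da x <= i < db x)%N).
Proof.
apply: measurable_and.
  under eq_fun do rewrite -(ler_nat R).
  by apply: measurable_fun_ler => //; case: bm_da.
under eq_fun do rewrite -(ltr_nat R).
by apply: measurable_fun_ltr => //; case: bm_db.
Qed.

Let bmF t i : bounded_measurable (F t i).
Proof.
apply: bounded_measurable_floor; apply: bounded_measurableD.
  by apply: bounded_measurableB; [exact: bounded_measurable_cst|exact: bounded_measurableZ].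
exact: bounded_measurable_cst.
Qed.

Let bmS t : bounded_measurable (S t).
Proof.
apply: bounded_measurable_sum => i.
by apply: bounded_measurable_if.
Qed.

Let bmC : bounded_measurable C.
Proof. exact: bounded_measurableB. Qed.

Let S_mono x : {homo S ^~ x : t u / t <= u}.
Proof.
move=> t u tu; apply: ler_sum => i _; case: ifP => // _.
by rewrite /F ler_int le_floor// lerD2r lerD2r.
Qed.

Let S1 t x : S (t + 1) x = S t x + C x.
Proof.
rewrite /C -(telescope_if (fun i => i%:R) (da_le_db x) (db_le_M x)) -big_split/=.
apply: eq_bigr => i _; case: ifP => _; last by rewrite addr0.
rewrite -natrB// subSnn /F.
have -> : t + 1 - s * v x + i%:R * th = (t - s * v x + i%:R * th) + 1 by ring.
by rewrite floorDrz ?rpred1// floor1 intrD.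
Qed.

(** Since [q * g = k * th + p], dropping the integer part [i] of [b * v x] before applying [G] moves
    the point by [k * i * th = da x * th], up to the integer [p * i]; the factor [q] is there to
    make this an integer. *)
Let fpart_GB t x :
  fpart (t - q%:R * v (G (B x))) = fpart (t - s * v x + (da x)%:R * th).
Proof.
set i := Num.truncn (b * v x); set z := Num.truncn (g * v (B x)).
apply: (@fpart_eq _ _ _ (p * i + q * z)%N).
have q0' : q%:R != 0 :> R by rewrite pnatr_eq0 -lt0n.
have -> : q%:R * v (G (B x)) =
    q%:R * b * g * v x - k%:R * i%:R * (q%:R * b) - p%:R * i%:R - q%:R * z%:R.
  by rewrite vGE -/z vBE -/i gE; field.
by rewrite -pmulrn natrD !natrM /s /th; ring.
Qed.

Let fpart_BG t x :
  fpart (t - q%:R * v (B (G x))) = fpart (t - s * v x + (db x)%:R * th).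
Proof.
set z := Num.truncn (b * v (G x)).
apply: (@fpart_eq _ _ _ (q * z)%N).
by rewrite vBE -/z vGE -/(db x) -pmulrn natrM /s /th; ring.
Qed.

(** Shifting [t] by [th] replaces [i] by [i + 1], so the difference telescopes to the two end
    floors. Writing each as argument minus fractional part leaves [C x * th] and the fractional
    parts of the two compositions. *)
Let S_th t x : S (t + th) x = S t x + (C x * th +
  (fpart (t - q%:R * v (G (B x))) - fpart (t - q%:R * v (B (G x))))).
Proof.
have -> : C x * th +
  (fpart (t - q%:R * v (G (B x))) - fpart (t - q%:R * v (B (G x)))) =
  F t (db x) x - F t (da x) x.
  by rewrite fpart_GB fpart_BG /F !floor_fpart /C; ring.
rewrite -(telescope_if (fun i => F t i x) (da_le_db x) (db_le_M x)) -big_split/=.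
apply: eq_bigr => i _; case: ifP => _; last by rewrite addr0.
rewrite addrC subrK /F.
by congr (Num.floor _)%:~R; rewrite -natr1; ring.
Qed.

(* [K] is affine with slope [c]: it is monotone and increases by [c] along [1]
   and by [c * th] along [th], the latter because both orders of composition of
   [B] and [G] preserve [mu]. So [mu], restricted to [da < db], is dominated by
   Lebesgue measure. *)
Let K t := \int[mu]_x S t x.
Let c := \int[mu]_x C x.

Let K_mono : {homo K : t u / t <= u}.
Proof.
move=> t u tu; apply: le_Rintegral => //; try exact: bounded_measurable_integrable.
by move=> x _; exact: S_mono.
Qed.

Let c_ge0 : 0 <= c.
Proof. by apply: Rintegral_ge0 => x _; rewrite subr_ge0 ler_nat. Qed.

Let K1 t : K (t + 1) = K t + c.
Proof.
rewrite /K /c -RintegralD//; try exact: bounded_measurable_integrable.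
by apply: eq_Rintegral => x _; rewrite S1.
Qed.

Let Kth t : K (t + th) = K t + c * th.
Proof.
pose f x := fpart (t - q%:R * v x).
have bmf : bounded_measurable f.
  by apply: bounded_measurable_fpart; apply: measurable_funB; last apply: measurable_funM.
have [mB _] := Bmu; have [mG _] := Gmu.
have bmG : bounded_measurable (fun x => f (G x)) := bounded_measurable_comp mG bmf.
have bmB : bounded_measurable (fun x => f (B x)) := bounded_measurable_comp mB bmf.
have bmGB : bounded_measurable (fun x => f (G (B x))) := bounded_measurable_comp mB bmG.
have bmBG : bounded_measurable (fun x => f (B (G x))) := bounded_measurable_comp mG bmB.
have bmCth : bounded_measurable (fun x => C x * th).
  by under eq_fun do rewrite mulrC; exact: bounded_measurableZ.
have int0 : \int[mu]_x (f (G (B x)) - f (B (G x))) = 0.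
  rewrite RintegralB//; try exact: bounded_measurable_integrable.
  rewrite (preserves_Rintegral Bmu bmG) (preserves_Rintegral Gmu bmB).
  by rewrite (preserves_Rintegral Gmu bmf) (preserves_Rintegral Bmu bmf) subrr.
transitivity (\int[mu]_x (S t x + (C x * th + (f (G (B x)) - f (B (G x)))))).
  by apply: eq_Rintegral => x _; rewrite S_th.
rewrite RintegralD//; try exact: bounded_measurable_integrable; last first.
  apply: bounded_measurable_integrable; apply: bounded_measurableD => //.
  exact: bounded_measurableB.
rewrite RintegralD//; try exact: bounded_measurable_integrable; last first.
  by apply: bounded_measurable_integrable; exact: bounded_measurableB.
by rewrite int0 addr0 RintegralZr//; exact: bounded_measurable_integrable.
Qed.

Let s_gt0 : 0 < s.
Proof. by rewrite /s !mulr_gt0// ltr0n. Qed.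

Lemma measurable_cell (u w : R) e :
  measurable [set x | u < v x <= w /\ (da x == e) && (e < db x)%N].
Proof.
have mc : measurable_fun setT
    (fun x => (u < v x <= w) && ((da x == e) && (e < db x)%N)).
  apply: measurable_and; first apply: measurable_and.
  - exact: measurable_fun_ltr.
  - exact: measurable_fun_ler.
  - apply: measurable_and.
      under eq_fun do rewrite -(eqr_nat R).
      by apply: measurable_fun_eqr => //; case: bm_da.
    under eq_fun do rewrite -(ltr_nat R).
    by apply: measurable_fun_ltr => //; case: bm_db.
have := mc measurableT [set true] I; rewrite setTI; congr measurable.
by apply/seteqP; split => x /=; [move=> /andP | move=> /andP ->].
Qed.

(** Where [da x = e < db x], the term of index [e] is present in [S] with a phase independent of
    [x]. It gains at least one between two suitable values of [t], while the other terms do not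
    decrease; integrating, the measure of the cell is at most an increment of [K]. *)
Lemma commutation_interval : exists2 c' : R, 0 <= c' & forall (u w : R) e, u <= w ->
  (mu [set x | (u < v x <= w)%R /\ (da x == e) && (e < db x)%N]
   <= (c' * (w - u))%:E)%E.
Proof.
exists (c * s) => [|u w e uw]; first by rewrite mulr_ge0// ltW.
set A := [set x | _].
have mA : measurable A by exact: measurable_cell.
(* At [t = U] and [t = W] the argument of the floor in [F t e x] is [s * (u - v x)] and
   [s * (w - v x)], of opposite signs (the second possibly zero) when [u < v x <= w]. *)
pose U := s * u - e%:R * th; pose W := s * w - e%:R * th.
have UW : U <= W by rewrite lerD2r ler_pM2l.
have KUW := monotone_quasiaffine irr_th K_mono c_ge0 K1 Kth UW.
have -> : mu A = (\int[mu]_x \1_A x)%:E.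
  rewrite /Rintegral integral_indic// setIT fineK//.
  exact: fin_num_measure.
rewrite lee_fin -mulrA mulrBr.
have -> : s * w - s * u = W - U by rewrite /W /U; ring.
apply: le_trans KUW; rewrite /K -RintegralB//; try exact: bounded_measurable_integrable.
apply: le_Rintegral => //.
- apply: bounded_measurable_integrable; split; first exact: measurable_indic.
  by exists 1 => x; rewrite indicE; case: (_ \in _); rewrite ?normr1 ?normr0.
- by apply: bounded_measurable_integrable; exact: bounded_measurableB.
move=> x _; rewrite indicE; case: (boolP (x \in A)) => [/set_mem|_]; last first.
  by rewrite subr_ge0 S_mono.
case=> [/andP[uv vw] /andP[/eqP dae edb]].
rewrite /S -sumrB.
have eM : (e < M)%N by exact: leq_trans (db_le_M x).
rewrite big_mkord (bigD1 (Ordinal eM))//= dae leqnn edb/=.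
rewrite -[leLHS]addr0 lerD//; last first.
  apply: sumr_ge0 => i _; case: ifP => // _.
  by rewrite subr_ge0 /F ler_int le_floor// lerD2r lerD2r.
rewrite /F /U /W.
have -> : s * w - e%:R * th - s * v x + e%:R * th = s * (w - v x) by ring.
have -> : s * u - e%:R * th - s * v x + e%:R * th = s * (u - v x) by ring.
have : 0 <= Num.floor (s * (w - v x)) by rewrite floor_ge0 mulr_ge0 ?subr_ge0// ltW.
have : Num.floor (s * (u - v x)) < 0 by rewrite floor_lt0 pmulr_rlt0// subr_lt0.
by move=> h1 h2; rewrite -intrB -[1]/(1%:~R) ler_int; lia.
Qed.

End commutation.

(** Lebesgue outer measure covers a null set by half-open intervals of arbitrarily small total
    length; sigma-subadditivity of [m] carries the bound from the intervals to the set. *)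
Lemma null_of_interval_bound {R : realType}
    (m : {measure set (measurableTypeR R) -> \bar R}) (c : R) :
  0 <= c ->
  (forall u w : R, u <= w -> (m `]u, w]%classic <= (c * (w - u))%:E)%E) ->
  forall N : set (measurableTypeR R), measurable N ->
    lebesgue_measure N = 0%E -> m N = 0%E.
Proof.
move=> c0 mc N mN N0; apply/eqP; rewrite eq_le measure_ge0 andbT.
apply/lee_addgt0Pr => e e0; rewrite add0e.
have e0' : 0 < e / (c + 1) by rewrite divr_gt0// ltr_wpDl.
have /ereal_inf_lt[z [/= M [ocM NM] Mz ze]] :
    (lebesgue_measure N < lebesgue_measure N + (e / (c + 1))%:E)%E.
  by rewrite lteDl ?lte_fin// N0.
rewrite N0 add0e in ze.
have mM i : measurable (M i : set (measurableTypeR R)).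
  by apply: sub_sigma_algebra; exact: ocM.
have mMi i : (m (M i) <= c%:E * wlength idfun (M i))%E.
  have /ocitvP[->|[[a b] /= ab ->]] := ocM i.
    by rewrite wlength0 mule0 measure0.
  by rewrite wlength_itv_bnd ?(ltW ab)// -EFinM; exact: (mc a b (ltW ab)).
apply: (@le_trans _ _ (\sum_(i <oo) m (M i))%E).
  apply: measure_sigma_subadditive => //.
apply: (@le_trans _ _ (\sum_(i <oo) (c%:E * wlength idfun (M i)))%E).
  by apply: lee_nneseries => // i _; exact: mMi.
rewrite nneseriesZl//.
rewrite Mz; apply: (le_trans (lee_wpmul2l _ (ltW ze))); first by rewrite lee_fin.
by rewrite -EFinM lee_fin mulrA ler_pdivrMr ?ltr_wpDl// mulrDr mulr1 mulrC lerDl ltW.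
Qed.

(** * Lebesgue measure under the beta-map *)

Section lebesgue_beta_map.
Context {R : realType}.
Local Notation lambda := (@lebesgue_measure R).
Implicit Types (b y : R) (E : set (measurableTypeR R)).

Lemma measurable_affine b y :
  measurable_fun setT (fun x : measurableTypeR R => b * x - y : measurableTypeR R).
Proof. by apply: measurable_funB => //; apply: measurable_funM. Qed.

(** By uniqueness of Lebesgue measure: [b] times the pushforward gives every half-open interval its
    length. *)
Lemma lebesgue_measure_affine b y E : 0 < b -> measurable E ->
  lambda ((fun x => b * x - y) @^-1` E) = (b^-1%:E * lambda E)%E.
Proof.
move=> b0 mE.
have b0' : 0 <= b by exact: ltW.
pose phi : measurableTypeR R -> measurableTypeR R := fun x => b * x - y.
have mphi : measurable_fun setT phi by exact: measurable_affine.
pose m : {measure set (measurableTypeR R) -> \bar R} :=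
  mscale (NngNum b0') (pushforward lambda phi).
have -> : lambda E = m mphi E.
  apply: lebesgue_measure_unique => //=.
  move=> _ [[u w]] _ <-; rewrite /mscale/= /pushforward.
  have -> : phi @^-1` `]u, w]%classic = `](u + y) / b, (w + y) / b]%classic.
    apply/seteqP; split => x /=; rewrite !in_itv/= /phi;
    by rewrite ltr_pdivrMr// ler_pdivlMr// ltrBrDr lerBlDr (mulrC x).
  rewrite !lebesgue_measure_itv/= !lte_fin ltr_pM2r ?invr_gt0// ltrD2r.
  case: ifP => _; last by rewrite mule0.
  by rewrite -EFinD -EFinD -EFinM; congr EFin; field; rewrite gt_eqF.
by rewrite /m /mscale /pushforward/= muleA -EFinM mulVf ?mul1e// gt_eqF.
Qed.

Lemma measurable_beta_map b :
  measurable_fun setT (beta_map b : measurableTypeR R -> measurableTypeR R).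
Proof.
have mf : measurable_fun [set: R] (@fpart R) := @measurable_fpart R.
apply: (measurableT_comp mf); exact: mulrl_measurable.
Qed.

Lemma measurable_beta_map_preimage b E : measurable E ->
  measurable (beta_map b @^-1` E : set (measurableTypeR R)).
Proof. by move=> mE; rewrite -[X in measurable X]setTI; exact: measurable_beta_map. Qed.

Lemma beta_map_nonsingular b E : 0 < b -> measurable E -> lambda E = 0%E ->
  lambda (beta_map b @^-1` E) = 0%E.
Proof.
move=> b0 mE E0.
have nE y : lambda.-negligible ((fun x : R => b * x - y) @^-1` E).
  apply/negligibleP; last by have := lebesgue_measure_affine y b0 mE; rewrite E0 mule0.
  by rewrite -[X in measurable X]setTI; exact: measurable_affine.
apply/negligibleP; first exact: measurable_beta_map_preimage.
(* At each point the map is an affine branch [b * x - z] with [z] an integer; the integers are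
   enumerated as [n] and [- n]. *)
have : lambda.-negligible
    (\bigcup_n ((fun x => b * x - n%:R) @^-1` E `|` (fun x => b * x - (- n%:R)) @^-1` E)).
  by apply: negligible_bigcup => n; apply: negligibleU.
apply: negligibleS => x; rewrite /= /beta_map /fpart => Ex.
exists `|Num.floor (b * x)|%N => //=; rewrite natr_absz.
have [f0|f0] := leP 0 (Num.floor (b * x)).
  by left; rewrite ger0_norm.
by right; rewrite ltr0_norm// intrN opprK.
Qed.

(** The union of all iterated preimages stays null by nonsingularity. It supplies null sets
    containing their preimages under both maps, over which invariance can be integrated. *)
Lemma null_closure b g N : 0 < b -> 0 < g -> measurable N -> lambda N = 0%E ->
  exists W : set (measurableTypeR R), [/\ measurable W, lambda W = 0%E, N `<=` W,
    beta_map b @^-1` W `<=` W & beta_map g @^-1` W `<=` W].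
Proof.
move=> b0 g0 mN N0.
pose step (A : set (measurableTypeR R)) : set (measurableTypeR R) :=
  A `|` (beta_map b @^-1` A `|` beta_map g @^-1` A).
pose Nk k := iter k step N.
have mNk k : measurable (Nk k).
  elim: k => // k IH; rewrite /Nk iterS -/(Nk k) /step.
  apply: measurableU => //.
  by apply: measurableU; exact: measurable_beta_map_preimage.
have Nk0 k : lambda (Nk k) = 0%E.
  elim: k => // k IH; apply/negligibleP => //.
  rewrite /Nk iterS -/(Nk k) /step; apply: negligibleU; first exact/negligibleP.
  by apply: negligibleU; apply/negligibleP;
    [exact: measurable_beta_map_preimage | exact: beta_map_nonsingular
    |exact: measurable_beta_map_preimage | exact: beta_map_nonsingular].
have mW : measurable (\bigcup_k Nk k) by exact: bigcupT_measurable.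
exists (\bigcup_k Nk k); split => //.
- apply/negligibleP => //; apply: negligible_bigcup => k.
  by apply/negligibleP; [exact: mNk | exact: Nk0].
- by move=> x Nx; exists 0%N.
- by move=> x [k _ kx]; exists k.+1 => //; right; left.
- by move=> x [k _ kx]; exists k.+1 => //; right; right.
Qed.

End lebesgue_beta_map.


(** * Null sets off zero are null for a common invariant measure *)

Section absolute_continuity.
Context d (X : measurableType d) {R : realType}.
Variable mu : {finite_measure set X -> \bar R}.
Variables (v : X -> R) (B G : X -> X) (b g : R) (k p q : nat).
Hypotheses (mv : measurable_fun setT v) (v01 : forall x, 0 <= v x < 1).
Hypotheses (Bmu : preserves mu B) (Gmu : preserves mu G).
Hypotheses (vB : forall x, v (B x) = beta_map b (v x)).
Hypotheses (vG : forall x, v (G x) = beta_map g (v x)).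
Hypotheses (b1 : 1 < b) (irr : irrational b) (g1 : 1 < g) (q0 : (0 < q)%N).
Hypothesis gE : g = k%:R * b + p%:R / q%:R.

Let da x := (k * Num.truncn (b * v x))%N.
Let db x := Num.truncn (g * v x).

Let mv' : measurable_fun setT (v : X -> measurableTypeR R).
Proof. exact: mv. Qed.

Let mpre (E : set (measurableTypeR R)) : measurable E -> measurable (v @^-1` E).
Proof. by move=> mE; rewrite -[X in measurable X]setTI; exact: mv'. Qed.

Let mcell e : measurable [set x | (da x == e) && (e < db x)%N].
Proof.
(* The interval []-1, 1]] contains all values of [v], so the cell is cut out by its conditions on
   [da] and [db] alone. *)
have := @measurable_cell _ X R v b g k mv v01 b1 g1 (-1) 1 e.
congr measurable; apply/seteqP; split => x /=; first by case.
by split=> //; case/andP: (v01 x) => ? ?; rewrite (lt_le_trans _ (_ : 0 <= v x))//= ?ltW// ltrN10.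
Qed.

(** The values of [da] split the set into countably many cells; on each, the image of [mu] under [v]
    satisfies the interval bound and so vanishes on null sets. *)
Lemma negligible_commutation (W : set (measurableTypeR R)) :
  measurable W -> lebesgue_measure W = 0%E ->
  mu.-negligible (v @^-1` W `&` [set x | (da x < db x)%N]).
Proof.
move=> mW W0.
have [c c0 cP] := commutation_interval mv v01 Bmu Gmu vB vG b1 irr g1 q0 gE.
have null e : mu.-negligible (v @^-1` W `&` [set x | (da x == e) && (e < db x)%N]).
  pose m : {measure set (measurableTypeR R) -> \bar R} :=
    pushforward (mrestr mu (mcell e)) (v : X -> measurableTypeR R).
  apply/negligibleP; first exact: measurableI (mpre mW) (mcell e).
  apply: (@null_of_interval_bound R (m mv') c c0 _ W mW W0) => u w uw.
  apply: le_trans (cP u w e uw); rewrite /m /pushforward /mrestr/=.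
  by rewrite le_eqVlt; apply/orP; left; apply/eqP; congr (mu _);
    apply/seteqP; split => x /=; rewrite in_itv.
have := negligible_bigcup null; apply: negligibleS => x [Wx ab].
by exists (da x) => //; split => //=; rewrite eqxx.
Qed.

Hypothesis kc : 1 < k%:R + p%:R / q%:R :> R.

Lemma Rintegral_negligible (f h : X -> R) (Z : set X) :
  bounded_measurable f -> bounded_measurable h -> mu.-negligible Z ->
  (forall x, ~ Z x -> f x = h x) -> \int[mu]_x f x = \int[mu]_x h x.
Proof.
move=> bf bh nZ fh; rewrite /Rintegral; congr fine; apply: ae_eq_integral => //.
- by apply/measurable_EFinP; case: bf.
- by apply/measurable_EFinP; case: bh.
apply: (@negligibleS _ _ _ _ Z) => // x /= nfh; apply: contrapT => nZx.
by apply: nfh => _; rewrite fh.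
Qed.

(* Off [da < db] one has [v (G x) = k * v (B x) + p / q * v x], without reduction
   mod 1. Integrating this over a null set [A] invariant under both maps gives
   [I = (k + p / q) * I] for [I = \int_A v], hence [I = 0]. *)
Lemma common_invariant_null (N : set (measurableTypeR R)) :
  measurable N -> lebesgue_measure N = 0%E ->
  mu (v @^-1` N `&` [set x | 0 < v x]) = 0%E.
Proof.
move=> mN N0.
have b0 : 0 < b by exact: lt_trans b1.
have g0 : 0 < g by exact: lt_trans g1.
have [W [mW W0 NW bW gW]] := null_closure b0 g0 mN N0.
pose A := v @^-1` W.
have mA : measurable A by exact: mpre.
have BA : B @^-1` A `<=` A by move=> x; rewrite /A /= vB => /bW.
have GA : G @^-1` A `<=` A by move=> x; rewrite /A /= vG => /gW.
(* [A] contains its preimage, which has the same finite measure, so the two differ by a negligible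
   set. *)
have diff T : preserves mu T -> T @^-1` A `<=` A -> mu.-negligible (A `\` T @^-1` A).
  move=> [mT muT] TA.
  have mTA : measurable (T @^-1` A) by rewrite -[X in measurable X]setTI; exact: mT.
  apply/negligibleP; first exact: measurableD.
  rewrite measureD//; last by rewrite ltey_eq fin_num_measure.
  rewrite (_ : A `&` T @^-1` A = T @^-1` A); last exact/setIidPr.
  by rewrite [X in (_ - X)%E](muT A mA) subee// fin_num_measure.
pose f x := \1_A x * v x.
have bmul (h : X -> R) : bounded_measurable h -> bounded_measurable (fun x => \1_A x * h x).
  case=> mh [M Mh]; split; first by apply: measurable_funM => //; exact: measurable_indic.
  exists M => x; rewrite indicE; case: (_ \in _); rewrite ?mul1r// mul0r normr0.
  exact: le_trans (Mh x).
have bmv : bounded_measurable v.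
  split=> //; exists 1 => x; have /andP[? ?] := v01 x.
  by rewrite ger0_norm// ltW.
have bmf : bounded_measurable f by exact: bmul.
have transfer T : preserves mu T -> T @^-1` A `<=` A ->
    \int[mu]_x f x = \int[mu]_x (\1_A x * v (T x)).
  move=> Tmu TA; have mT := Tmu.1.
  rewrite -(preserves_Rintegral Tmu bmf).
  apply: Rintegral_negligible (diff T Tmu TA) _.
  - exact: (bounded_measurable_comp mT bmf).
  - exact/bmul/(bounded_measurable_comp mT).
  move=> x nZ; rewrite /f !indicE.
  have [TAx|TAx] := pselect (A (T x)).
    by rewrite !mem_set//; exact: TA.
  have Ax : ~ A x by move=> Ax; apply: nZ.
  by rewrite !memNset// !mul0r.
have nc := negligible_commutation mW W0.
have If0 : \int[mu]_x f x = 0.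
  have bmB := bmul _ (bounded_measurable_comp Bmu.1 bmv).
  have bmG := bmul _ (bounded_measurable_comp Gmu.1 bmv).
  set I := \int[mu]_x f x.
  have IE : I = (k%:R + p%:R / q%:R) * I.
    rewrite {1}/I (transfer G Gmu GA).
    rewrite (@Rintegral_negligible _
      (fun x => k%:R * (\1_A x * v (B x)) + p%:R / q%:R * f x) _ bmG _ nc); last first.
    - move=> x nZ; rewrite /f indicE.
      have [Ax|Ax] := pselect (A x); last by rewrite memNset// !mul0r !mulr0 addr0.
      rewrite mem_set// !mul1r.
      have bv0 : 0 <= b * v x by rewrite mulr_ge0 ?(ltW b0)//; case/andP: (v01 x).
      have gv0 : 0 <= g * v x by rewrite mulr_ge0 ?(ltW g0)//; case/andP: (v01 x).
      have da_le_db : (da x <= db x)%N.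
        rewrite truncn_ge_nat// gE mulrDl natrM -mulrA -[leLHS]addr0 lerD//.
          by rewrite ler_wpM2l// truncn_le.
        by apply: mulr_ge0; [exact: divr_ge0 | case/andP: (v01 x)].
      have dab : da x = db x.
        apply/eqP; rewrite eqn_leq da_le_db leqNgt; apply/negP => ab.
        by apply: nZ.
      rewrite vG vB /beta_map !fpart_truncn// -/(db x) -dab /da natrM {1}gE; ring.
    - apply: bounded_measurableD; exact: bounded_measurableZ.
    rewrite RintegralD//; try by apply: bounded_measurable_integrable; exact: bounded_measurableZ.
    rewrite !RintegralZl//; try exact: bounded_measurable_integrable.
    by rewrite -(transfer B Bmu BA) mulrDl.
  have : (k%:R + p%:R / q%:R - 1) * I = 0 by rewrite mulrBl -IE mul1r subrr.
  by move/eqP; rewrite mulf_eq0 subr_eq0 gt_eqF//= => /eqP.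
have f0 x : 0 <= f x.
  by rewrite mulr_ge0//; case/andP: (v01 x).
have : ae_eq mu setT (EFin \o f) (cst 0%E).
  apply/ae_eq_integral_abs => //; first by apply/measurable_EFinP; case: bmf.
  transitivity (\int[mu]_x (f x)%:E)%E.
    by apply: eq_integral => x _; rewrite /= ger0_norm.
  rewrite -[LHS]fineK; first by rewrite -[fine _]/(\int[mu]_x f x) If0.
  apply: integrable_fin_num => //; exact: bounded_measurable_integrable.
move=> nf; apply: measure_negligible.
  apply: measurableI; first exact: mpre.
  rewrite -[X in measurable X]setTI -preimage_itvoy.
  exact: mv.
apply: negligibleS nf => x [/NW Wx v0] /= /(_ I) [].
by rewrite /f indicE mem_set// mul1r => vx0; move: v0; rewrite /= vx0 ltxx.
Qed.

End absolute_continuity.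


(** * Parry's invariant measure *)

Definition ico {R : realType} (u w : R) : set (measurableTypeR R) :=
  `[u, w[%classic.
Arguments ico {R} (u w)%_ring_scope.

Section ico.
Context {R : realType}.
Local Notation lambda := (@lebesgue_measure R).
Implicit Types u w x : R.

Lemma icoE u w x : ico u w x = (u <= x < w) :> Prop.
Proof. by rewrite /ico /= in_itv. Qed.

Lemma measurable_ico u w : measurable (ico u w).
Proof. exact: measurable_itv. Qed.

Lemma lebesgue_measure_ico u w : u <= w -> lambda (ico u w) = (w - u)%:E.
Proof.
move=> uw; rewrite /ico lebesgue_measure_itv/= lte_fin -EFinD.
by case: ltgtP uw => // -> _; rewrite subrr.
Qed.

End ico.

Section parry.
Context {R : realType}.
Local Notation lambda := (@lebesgue_measure R).
Local Notation D := (@ico R 0 1).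
Implicit Types (r : R) (E : set (measurableTypeR R)).
Variable b : R.
Hypothesis b1 : 1 < b.
Local Notation T := (beta_map b).

Let b0 : 0 < b. Proof. exact: lt_trans b1. Qed.

(** As [s <= 1], the integer part of [b * x] is constantly [n] on this interval, and the map is the
    affine branch [b * x - n]. *)
Lemma lebesgue_piece (n : nat) (s : R) E : measurable E -> 0 <= s <= 1 ->
  lambda (ico (n%:R / b) ((n%:R + s) / b) `&` T @^-1` E) =
  (b^-1%:E * lambda (ico 0 s `&` E))%E.
Proof.
move=> mE /andP[s0 s1].
rewrite -(lebesgue_measure_affine n%:R b0); last by apply: measurableI => //; exact: measurable_ico.
congr (lambda _); apply/seteqP; split => x /=; rewrite !icoE /beta_map.
  rewrite ler_pdivrMr// ltr_pdivlMr// (mulrC x) => -[/andP[nx xn] Ex].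
  have x0 : 0 <= b * x by apply: le_trans nx.
  have tx : Num.truncn (b * x) = n.
    apply: truncn_def; rewrite nx/= -natr1 (lt_le_trans xn)// lerD2l//.
  rewrite fpart_truncn// tx in Ex; split => //.
  by rewrite subr_ge0 nx ltrBlDl.
rewrite ler_pdivrMr// ltr_pdivlMr// (mulrC x) subr_ge0 ltrBlDl => -[/andP[nx xn] Ex].
rewrite nx xn; split => //.
have tx : Num.truncn (b * x) = n.
  by apply: truncn_def; rewrite nx/= -natr1 (lt_le_trans xn)// lerD2l.
by rewrite fpart_truncn ?tx//; apply: le_trans nx.
Qed.

(** [[0, r)] consists of [Num.truncn (b * r)] full branches, each mapped onto [[0, 1)], and one
    partial branch mapped onto [[0, T r)]. *)
Lemma lebesgue_preimage_ico r E : measurable E -> 0 <= r ->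
  lambda (ico 0 r `&` T @^-1` E) =
  (b^-1%:E * ((Num.truncn (b * r))%:R%:E * lambda (D `&` E)
              + lambda (ico 0 (T r) `&` E)))%E.
Proof.
move=> mE r0.
have key (n : nat) (s : R) : 0 <= s <= 1 ->
    lambda (ico 0 ((n%:R + s) / b) `&` T @^-1` E) =
    (b^-1%:E * (n%:R%:E * lambda (D `&` E) + lambda (ico 0 s `&` E)))%E.
  elim: n s => [|n IH] s s01.
    have := lebesgue_piece 0 mE s01; rewrite mul0r => ->.
    by rewrite mul0e add0e.
  have /andP[s0 s1] := s01.
  rewrite (_ : ico 0 ((n.+1%:R + s) / b) `&` T @^-1` E =
      (ico 0 ((n%:R + 1) / b) `&` T @^-1` E) `|`
      (ico (n.+1%:R / b) ((n.+1%:R + s) / b) `&` T @^-1` E)); last first.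
    rewrite -setIUl natr1; congr (_ `&` _).
    by rewrite /ico -itv_bndbnd_setU// bnd_simp ?divr_ge0 ?(ltW b0)// ler_pM2r ?invr_gt0// lerDl.
  have mTE : measurable (T @^-1` E : set (measurableTypeR R)).
    exact: measurable_beta_map_preimage.
  rewrite measureU; [|by apply: measurableI => //; exact: measurable_ico..|]; last first.
    apply/seteqP; split => // x /=; rewrite !icoE => -[[/andP[_ +] _] [/andP[+ _] _]].
    by rewrite natr1 => h1 h2; have := lt_le_trans h1 h2; rewrite ltxx.
  (* The first [n + 1] full branches are the case [s = 1] of the induction hypothesis, which is why
     [s = 1] is allowed. *)
  have IH1 := IH 1; rewrite ler01 lexx in IH1.
  transitivity (b^-1%:E * (n%:R%:E * lambda (D `&` E) + lambda (D `&` E)) +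
                b^-1%:E * lambda (ico 0 s `&` E))%E.
    by congr (_ + _)%E; [exact: IH1 | exact: lebesgue_piece].
  rewrite -ge0_muleDr ?adde_ge0 ?mule_ge0//.
  congr (_ * (_ + _))%E.
  by rewrite -natr1 EFinD ge0_muleDl// mul1e.
have br0 : 0 <= b * r by rewrite mulr_ge0// ltW.
have := key (Num.truncn (b * r)) (T r).
rewrite /beta_map fpart_truncn// subrKC mulrAC mulfV ?gt_eqF// mul1r; apply.
by rewrite -fpart_truncn// fpart_ge0 ltW// fpart_lt1.
Qed.

End parry.


Section parry_measure.
Context {R : realType}.
Local Notation lambda := (@lebesgue_measure R).
Local Notation D := (@ico R 0 1).
Implicit Types (r : R) (E : set (measurableTypeR R)).
Variable b : R.

(* [parry] has density [\sum_n b^-n 1_[0, T^n 1)], Parry's density for [b]; the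
   absolute value in the weight only serves to have a measure for every [b]. *)
Definition parry_orbit (n : nat) : R := iter n (beta_map b) 1.

Definition parry_weight (n : nat) : {nonneg R} := NngNum (normr_ge0 (b ^- n)).

Definition parry : set (measurableTypeR R) -> \bar R :=
  mseries (fun n => mscale (parry_weight n)
    (mrestr lambda (measurable_ico 0 (parry_orbit n)))) 0.

HB.instance Definition _ := Measure.on parry.

Hypothesis b1 : 1 < b.
Local Notation T := (beta_map b).

Let b0 : 0 < b. Proof. exact: lt_trans b1. Qed.

Lemma parry_orbitS n : parry_orbit n.+1 = T (parry_orbit n).
Proof. by rewrite /parry_orbit iterS. Qed.

Lemma parry_orbit_ge0 n : 0 <= parry_orbit n.
Proof. by case: n => [|n]; rewrite ?parry_orbitS /beta_map ?fpart_ge0// ler01. Qed.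

Lemma parry_orbit_le1 n : parry_orbit n <= 1.
Proof. by case: n => [|n]; rewrite ?parry_orbitS /beta_map// ltW// fpart_lt1. Qed.

Lemma parryE E : parry E =
  (\sum_(0 <= n <oo) ((b ^- n)%:E * lambda (ico 0 (parry_orbit n) `&` E)))%E.
Proof.
rewrite /parry /mseries; apply: eq_eseriesr => n _.
rewrite /mscale /mrestr setIC; congr (_%:E * _)%E.
by rewrite [LHS]ger0_norm// invr_ge0 exprn_ge0// ltW.
Qed.

Lemma parry_series_weight : (\sum_(0 <= n <oo) (b ^- n)%:E = (b / (b - 1))%:E :> \bar R)%E.
Proof.
apply/cvg_lim => //; rewrite (_ : (fun n => _) = EFin \o series (fun n => b ^- n)); last first.
  by apply/funext => n /=; rewrite /series/= sumEFin.
apply: cvg_EFin; first by near=> n.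
have -> : b / (b - 1) = 1 / (1 - b^-1).
  by field; rewrite ?subr_eq0 ?(gt_eqF b1) ?gt_eqF// lt_eqF.
rewrite (_ : (fun n => b ^- n) = geometric 1 b^-1); last first.
  by apply/funext => n; rewrite /geometric/= mul1r exprVn.
apply: cvg_geometric_series.
by rewrite ger0_norm ?invr_ge0 ?(ltW b0)// invf_lt1.
Unshelve. all: by end_near. Qed.

Let weight_ge0 n : 0 <= b ^- n.
Proof. by rewrite invr_ge0 exprn_ge0// ltW. Qed.

Lemma parry_term_ge0 E n :
  (0 <= (b ^- n)%:E * lambda (ico 0 (parry_orbit n) `&` E))%E.
Proof. by rewrite mule_ge0// lee_fin. Qed.

Lemma parry_le E (c : R) : measurable E -> 0 <= c ->
  (forall n, lambda (ico 0 (parry_orbit n) `&` E) <= c%:E)%E ->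
  (parry E <= (b / (b - 1) * c)%:E)%E.
Proof.
move=> mE c0 Ec; rewrite parryE mulrC EFinM -parry_series_weight -nneseriesZl; last first.
  by move=> n _; rewrite lee_fin.
apply: lee_nneseries => [n _ _|n _]; first exact: parry_term_ge0.
by rewrite muleC lee_wpmul2r// lee_fin.
Qed.

(** The term [n = 0] is already Lebesgue measure on [[0, 1)], because the orbit starts at [1]. *)
Lemma parry_ge E : measurable E -> (lambda (D `&` E) <= parry E)%E.
Proof.
move=> mE; rewrite parryE.
apply: le_trans (nneseries_lim_ge 1 _); last by move=> n _ _; exact: parry_term_ge0.
by rewrite big_nat1 expr0 invr1 mul1e.
Qed.

Lemma parry_null E : measurable E -> lambda (D `&` E) = 0%E -> parry E = 0%E.
Proof.
move=> mE E0; rewrite parryE eseries0// => n _ _.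
rewrite [X in (_ * X)%E](_ : _ = 0%E) ?mule0//.
apply: subset_measure0 E0.
- by apply: measurableI => //; exact: measurable_ico.
- by apply: measurableI => //; exact: measurable_ico.
apply: setSI => x; rewrite !icoE => /andP[-> /lt_le_trans]; apply.
exact: parry_orbit_le1.
Qed.

Lemma parry_fin E : measurable E -> parry E \is a fin_num.
Proof.
move=> mE; rewrite ge0_fin_numE//.
apply: le_lt_trans (parry_le mE ler01 _) (ltry _) => n.
apply: le_trans (_ : lambda (ico 0 (parry_orbit n)) <= _)%E.
  apply: le_measure; rewrite ?inE//; last exact: measurable_ico.
  by apply: measurableI => //; exact: measurable_ico.
by rewrite lebesgue_measure_ico ?parry_orbit_ge0// subr0 lee_fin parry_orbit_le1.
Qed.

(** The beta-expansion of [1]: each summand is a difference of consecutive values of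
    [b ^- n * parry_orbit n], so the partial sums telescope and the remainder tends to zero. *)
Lemma parry_digits :
  (\sum_(0 <= n <oo)
     (b ^- n.+1 * (Num.truncn (b * parry_orbit n))%:R)%:E = 1%:E :> \bar R)%E.
Proof.
have digit n : b ^- n.+1 * (Num.truncn (b * parry_orbit n))%:R =
    b ^- n * parry_orbit n - b ^- n.+1 * parry_orbit n.+1.
  rewrite parry_orbitS /beta_map fpart_truncn ?mulr_ge0 ?parry_orbit_ge0 ?(ltW b0)//.
  by rewrite exprS; field; rewrite !gt_eqF ?exprn_gt0.
have partial N : \sum_(0 <= n < N) (b ^- n.+1 * (Num.truncn (b * parry_orbit n))%:R) =
    1 - b ^- N * parry_orbit N.
  elim: N => [|N IH]; first by rewrite big_geq// expr0 invr1 mul1r subrr.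
  by rewrite big_nat_recr// IH digit [LHS]addrA subrK.
apply/cvg_lim => //.
rewrite (_ : (fun n => _) = EFin \o (fun N => 1 - b ^- N * parry_orbit N)); last first.
  by apply/funext => N /=; rewrite -partial sumEFin.
apply: cvg_EFin; first by near=> n.
rewrite -[X in _ --> X]subr0; apply: cvgB; first exact: cvg_cst.
apply: (@squeeze_cvgr _ _ _ _ (fun=> 0) (fun N => b^-1 ^+ N)).
- near=> N; rewrite mulr_ge0 ?parry_orbit_ge0//= exprVn -[leRHS]mulr1.
  by rewrite ler_wpM2l// parry_orbit_le1.
- exact: cvg_cst.
- by apply: cvg_expr; rewrite ger0_norm ?invr_ge0 ?(ltW b0)// invf_lt1.
Unshelve. all: by end_near. Qed.

(** Taking the preimage turns the [n]-th term into the next one plus a digit of the expansion of [1]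
    times [l]. The digits sum to one and so restore the missing term [n = 0], which is [l]. *)
Lemma parry_invariant E : measurable E -> parry (T @^-1` E) = parry E.
Proof.
move=> mE; rewrite !parryE.
pose l := lambda (D `&` E).
pose t n := ((b ^- n)%:E * lambda (ico 0 (parry_orbit n) `&` E))%E.
transitivity (\sum_(0 <= n <oo)
   ((b ^- n.+1 * (Num.truncn (b * parry_orbit n))%:R)%:E * l + t n.+1))%E.
  apply: eq_eseriesr => n _.
  rewrite (lebesgue_preimage_ico b1 mE (parry_orbit_ge0 n)) /t -parry_orbitS.
  rewrite muleA -EFinM -invfM -exprSr ge0_muleDr// ?muleA -?EFinM//.
  by rewrite mule_ge0.
rewrite nneseriesD; last 2 first.
- by move=> n _ _; apply: mule_ge0; [rewrite lee_fin mulr_ge0 | exact: measure_ge0].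
- by move=> n _ _; exact: parry_term_ge0.
have lfin : l \is a fin_num.
  rewrite ge0_fin_numE; last exact: measure_ge0.
  by apply: le_lt_trans (parry_ge mE) _; rewrite ltey_eq parry_fin.
rewrite -(fineK lfin).
under eq_eseriesr do rewrite muleC.
rewrite nneseriesZl; last by move=> n _; rewrite lee_fin mulr_ge0.
rewrite parry_digits mule1 (fineK lfin) [RHS]nneseries_recl//; last first.
  by move=> n _; exact: parry_term_ge0.
rewrite expr0 invr1 mul1e; congr (_ + _)%E.
by rewrite -(nneseries_addn 1); [apply: eq_eseriesr => n _; rewrite addn1|
  move=> n; exact: parry_term_ge0].
Qed.

End parry_measure.


(** * Ergodicity of the beta-map for Lebesgue measure *)

Section ergodicity.
Context {R : realType}.
Local Notation lambda := (@lebesgue_measure R).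
Local Notation D := (@ico R 0 1).
Implicit Types (r : R) (E U : set (measurableTypeR R)).

(** The rays []-oo, x[] are a generating pi-system, and each meets [[0, 1)] in [[0, r)] with [r] the
    clamp of [x] to [[0, 1]]. *)
Lemma eq_measure_ico (m1 m2 : {measure set (measurableTypeR R) -> \bar R}) :
  (forall r, 0 <= r <= 1 -> m1 (ico 0 r) = m2 (ico 0 r)) ->
  m1 (~` D) = 0%E -> m2 (~` D) = 0%E -> (m1 D < +oo)%E ->
  forall E, measurable E -> m1 E = m2 E.
Proof.
move=> m12 m1D m2D m1fin.
have mD : measurable D by exact: measurable_ico.
have restr (m : {measure set (measurableTypeR R) -> \bar R}) E :
    measurable E -> m (~` D) = 0%E -> m E = m (E `&` D).
  move=> mE mD0; rewrite (measureDI m mE mD) [X in (X + _)%E](_ : _ = 0%E) ?add0e//.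
  by apply: subset_measure0 mD0; [exact: measurableD|exact: measurableC|move=> x []].
have Ix x : `]-oo, x[%classic `&` D = ico 0 (Num.max 0 (Num.min x 1)).
  apply/seteqP; split => y /=; rewrite !icoE in_itv/= lt_max lt_min.
    by move=> [-> /andP[-> ->]]; rewrite orbT.
  by move=> /andP[y0]; rewrite ltNge y0/= => /andP[-> ->].
have bnd x : 0 <= Num.max 0 (Num.min x 1) <= (1 : R).
  by rewrite le_max lexx ge_max ler01 ge_min lexx orbT.
move=> E mE; refine (@measure_unique _ _ (measurableTypeR R) (@RGenInftyO.G R)
  (fun k => `]-oo, k%:R[%classic) _ _ _ _ m1 m2 _ _ E mE).
- exact: RGenInftyO.measurableE.
- move=> _ _ [x ->] [y ->]; exists (Num.min x y).
  by apply/seteqP; split => z /=; rewrite !in_itv/= lt_min; [move=> [-> ->] | move=> /andP].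
- by move=> k; exists k%:R.
- apply/seteqP; split => // x _; exists (Num.truncn x).+1 => //=.
  by rewrite in_itv/= truncnS_gt.
- move=> _ [x ->].
  by rewrite (restr m1)// (restr m2)//; rewrite Ix m12.
move=> k; rewrite (restr m1)//; apply: le_lt_trans m1fin.
by apply: le_measure; rewrite ?inE//; apply: measurableI.
Qed.

Variable b : R.
Hypothesis b1 : 1 < b.
Local Notation T := (beta_map b).

Let b0 : 0 < b. Proof. exact: lt_trans b1. Qed.

(* [L r - r * l] is divided by [b] when [r] is replaced by its preimage, so it
   vanishes; hence [U] has the same density [l] in every interval. *)
Lemma beta_map_ergodic U : measurable U -> T @^-1` U `<=` U ->
  lambda (D `&` U) = 0%E \/ lambda (D `\` U) = 0%E.
Proof.
move=> mU TU.
have mD : measurable D by exact: measurable_ico.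
have mTU : measurable (T @^-1` U : set (measurableTypeR R)).
  exact: measurable_beta_map_preimage.
(* [parry b] is finite and invariant, so it vanishes on this difference, and it dominates Lebesgue
   measure on [D]. *)
have null : lambda (D `&` (U `\` T @^-1` U)) = 0%E.
  apply/eqP; rewrite eq_le measure_ge0 andbT.
  apply: le_trans (parry_ge b1 (measurableD mU mTU)) _.
  rewrite measureD//; last by rewrite ltey_eq parry_fin.
  rewrite (_ : U `&` T @^-1` U = T @^-1` U); last exact/setIidPr.
  by rewrite [X in (_ - X)%E](parry_invariant b1 mU) subee// parry_fin.
have fin r E : measurable E -> lambda (ico 0 r `&` E) \is a fin_num.
  move=> mE; rewrite ge0_fin_numE//.
  apply: le_lt_trans (_ : lambda (ico 0 r) < +oo)%E.
    apply: le_measure; rewrite ?inE//; first apply: measurableI => //.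
      exact: measurable_ico.
    exact: measurable_ico.
  rewrite /ico lebesgue_measure_itv/=; case: ifP => // _.
  by rewrite -EFinD ltry.
pose L r := fine (lambda (ico 0 r `&` U)).
pose l := L 1.
have LE r : 0 <= r <= 1 -> lambda (ico 0 r `&` U) = lambda (ico 0 r `&` T @^-1` U).
  move=> /andP[r0 r1].
  rewrite (_ : ico 0 r `&` U =
      (ico 0 r `&` T @^-1` U) `|` (ico 0 r `&` (U `\` T @^-1` U))); last first.
    by rewrite -setIUr setDE setUIr setUv setIT setUidr.
  have mr : measurable (ico 0 r) by exact: measurable_ico.
  rewrite measureU; [|exact: measurableI|by apply: measurableI => //; exact: measurableD|].
    rewrite [X in (_ + X)%E](_ : _ = 0%E) ?adde0//.
    apply: subset_measure0 null.
    - by apply: measurableI => //; exact: measurableD.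
    - by apply: measurableI => //; exact: measurableD.
    by apply: setSI => x; rewrite !icoE => /andP[-> /lt_le_trans]; apply.
  by apply/seteqP; split => // x [[_ Tx] [_ [_ nTx]]].
have G r : 0 <= r <= 1 -> L r - r * l = b^-1 * (L (T r) - T r * l).
  move=> r01; have /andP[r0 r1] := r01.
  rewrite /L (LE r r01) (lebesgue_preimage_ico b1 mU r0).
  rewrite fineM//; last by rewrite fin_numD fin_numM ?fin.
  rewrite fineD ?fin_numM ?fin// fineM ?fin//= -/(L 1) -/l -/(L _).
  move: (L (T r)) => LT; rewrite /beta_map fpart_truncn ?mulr_ge0 ?(ltW b0)//.
  by field; rewrite gt_eqF.
have L01 r : 0 <= r <= 1 -> 0 <= L r <= 1.
  move=> /andP[r0 r1]; rewrite /L fine_ge0//= -lee_fin fineK ?fin//.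
  apply: le_trans (_ : lambda (ico 0 r) <= _)%E.
    apply: le_measure; rewrite ?inE//; last exact: measurable_ico.
    by apply: measurableI => //; exact: measurable_ico.
  by rewrite lebesgue_measure_ico// subr0 lee_fin.
have Gn n r : 0 <= r <= 1 -> `|L r - r * l| <= b^-1 ^+ n.
  elim: n r => [|n IH] r r01.
    rewrite expr0 ler_norml.
    have /andP[? ?] := L01 r r01; have /andP[l0 l1] : 0 <= l <= 1 by rewrite L01// ler01 lexx.
    have /andP[r0 r1] := r01.
    have : 0 <= r * l by exact: mulr_ge0.
    have : r * l <= 1 by exact: mulr_ile1.
    by move=> ? ?; apply/andP; split; lra.
  rewrite G// normrM ger0_norm ?invr_ge0 ?(ltW b0)// exprS ler_pM2l ?invr_gt0// IH//.
  by case/andP: (beta_map_itv b r) => ->/= /ltW.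
have Lr r : 0 <= r <= 1 -> L r = r * l.
  move=> r01; apply/eqP; rewrite -subr_eq0 -normr_le0.
  have cv : b^-1 ^+ n @[n --> \oo] --> (0 : R).
    by apply: cvg_expr; rewrite ger0_norm ?invr_ge0 ?(ltW b0)// invf_lt1.
  rewrite -(cvg_lim (@Rhausdorff R) cv); apply: limr_ge; first by apply/cvg_ex; exists 0.
  by near=> n; exact: Gn.
have l0 : 0 <= l by rewrite fine_ge0.
(* Lebesgue measure on [D] restricted to [U] equals [l] times Lebesgue measure on [D]; evaluated on
   [D] minus [U] this reads [0 = l * lambda (D minus U)]. *)
pose m1 := mrestr lambda (measurableI _ _ mD mU).
pose m2 := mscale (NngNum l0) (mrestr lambda mD).
have m1E A : m1 A = lambda (A `&` (D `&` U)) by [].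
have m2E A : m2 A = (l%:E * lambda (A `&` D))%E by [].
have m12 : m1 (D `\` U) = m2 (D `\` U).
  apply: (@eq_measure_ico m1 m2); last exact: measurableD.
  - move=> r r01; have /andP[r0 r1] := r01; rewrite [LHS]m1E [RHS]m2E.
    have rD : ico 0 r `&` D = ico 0 r.
      by apply/setIidPl => x; rewrite !icoE => /andP[-> /lt_le_trans]; apply.
    rewrite setIA rD lebesgue_measure_ico// subr0 -EFinM -(fineK (fin r U mU)).
    by rewrite -/(L r) Lr// mulrC.
  - by rewrite [LHS]m1E setIA setICl set0I measure0.
  - by rewrite [LHS]m2E setICl measure0 mule0.
  - rewrite [X in (X < _)%E]m1E setIA setIid.
    by rewrite ltey_eq fin.
move: m12; rewrite m1E m2E.
rewrite (_ : (D `\` U) `&` (D `&` U) = set0); last first.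
  by apply/seteqP; split => // x [[_ nU] [_ /nU]].
rewrite measure0 setIC setIDA setIid => /esym/eqP.
rewrite mule_eq0 => /orP[|/eqP ->]; last by right.
rewrite eqe => /eqP l00; left.
by rewrite -(fineK (fin 1 U mU)) -/(L 1) -/l l00.
Unshelve. all: by end_near. Qed.

End ergodicity.


(** * Uniqueness of the absolutely continuous invariant measure *)

Lemma finite_measure_difference d (X : measurableType d) {R : realType}
    (m1 m2 : {finite_measure set X -> \bar R}) (c : R) :
  exists P (jp jn : {finite_measure set X -> \bar R}),
    [/\ measurable P, jp (~` P) = 0%E, jn P = 0%E &
    forall E : set X, measurable E ->
      (m1 E - c%:E * m2 E = jp E - jn E)%E].
Proof.
pose nu : {charge set X -> \bar R} :=
  cadd (charge_of_finite_measure m1) (cscale (- c) (charge_of_finite_measure m2)).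
have [P [N nuPN]] := Hahn_decomposition nu.
have [[mP _] [mN _] PN PN0] := nuPN.
have NE : N = ~` P.
  apply/seteqP; split => x; first by move=> Nx Px; rewrite -[False]/(set0 x) -PN0.
  by move=> nPx; have [//|//] : (P `|` N) x by rewrite PN.
exists P, (jordan_pos nuPN), (jordan_neg nuPN); split => //.
- rewrite [LHS]jordan_posE cjordan_posE /crestr0 mem_set; last exact: measurableC.
  by rewrite /crestr setICl charge0.
- rewrite [LHS]jordan_negE cjordan_negE /crestr0 mem_set//.
  by rewrite /crestr PN0 charge0 oppe0.
- move=> E mE; have := jordan_decomp nuPN mE.
  rewrite -[LHS]/(m1 E + (- c)%:E * m2 E)%E.
  by rewrite -[RHS]/(jordan_pos nuPN E + (-1)%:E * jordan_neg nuPN E)%E !EFinN mulNe mulN1e.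
Qed.

Section acim.
Context {R : realType}.
Local Notation lambda := (@lebesgue_measure R).
Local Notation D := (@ico R 0 1).
Implicit Types (E : set (measurableTypeR R)).
Variable b : R.
Hypothesis b1 : 1 < b.
Local Notation T := (beta_map b).

(** With [c] equalizing total masses, take the Jordan parts of [m - c * parry b]. The union [U] of
    the preimages of the positive set is null for the negative part, and its complement for the
    positive part. By ergodicity [U] or its complement is null, so one part vanishes, and then both
    do, their masses being equal. *)
Lemma acim_unique (m : {finite_measure set (measurableTypeR R) -> \bar R}) :
  m (~` D) = 0%E ->
  (forall E, measurable E -> lambda E = 0%E -> m E = 0%E) ->
  (forall E, measurable E -> m (T @^-1` E) = m E) ->
  exists2 c : R, 0 <= c & forall E, measurable E -> m E = (c%:E * parry b E)%E.
Proof.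
move=> mD0 mac minv.
have mD : measurable D by exact: measurable_ico.
have fp : fin_num_fun (parry b) by move=> E mE; exact: parry_fin.
pose pi : {finite_measure set (measurableTypeR R) -> \bar R} :=
  HB.pack (parry b) (Measure_isFinite.Build _ _ _ (parry b) fp).
have pinull E : measurable E -> lambda (D `&` E) = 0%E -> pi E = 0%E.
  exact: parry_null.
have pinv E : measurable E -> pi (T @^-1` E) = pi E by exact: parry_invariant.
have mT := @measurable_beta_map_preimage R b.
have piD0 : pi (~` D) = 0%E.
  by apply: pinull; [exact: measurableC | rewrite setICr measure0].
have mnull E : measurable E -> lambda (D `&` E) = 0%E -> m E = 0%E.
  move=> mE E0; rewrite (measureDI m mE mD).
  rewrite [X in (X + _)%E](_ : _ = 0%E) ?add0e; last first.
    by apply: subset_measure0 mD0; [exact: measurableD|exact: measurableC|move=> x []].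
  by rewrite setIC; apply: mac => //; exact: measurableI.
have tot (n : {finite_measure set (measurableTypeR R) -> \bar R}) :
    n (~` D) = 0%E -> n setT = n D.
  by move=> nD0; rewrite (measureDI n measurableT mD) setTD [X in (X + _)%E]nD0 add0e setTI.
have pige : 1 <= fine (pi D).
  rewrite -lee_fin fineK ?fin_num_measure//.
  apply: le_trans (parry_ge b1 mD).
  by rewrite setIid lebesgue_measure_ico// subr0.
pose c := fine (m D) / fine (pi D).
have c0 : 0 <= c by rewrite divr_ge0// fine_ge0.
exists c => //.
have [P [jp [jn [mP jpP jnP dec]]]] := finite_measure_difference m pi c.
have fm (n : {finite_measure set (measurableTypeR R) -> \bar R}) E :
  measurable E -> n E = (fine (n E))%:E.
  by move=> mE; rewrite fineK// fin_num_measure.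
have decR E : measurable E -> fine (m E) - c * fine (pi E) = fine (jp E) - fine (jn E).
  by move=> mE; apply: EFin_inj; rewrite !EFinB EFinM -!fm//; exact: dec.
have mono (n : {finite_measure set (measurableTypeR R) -> \bar R}) E F :
    measurable E -> measurable F -> E `<=` F -> fine (n E) <= fine (n F).
  by move=> mE mF EF; rewrite fine_le ?fin_num_measure// le_measure ?inE.
have nonneg (n : {finite_measure set (measurableTypeR R) -> \bar R}) E :
  0 <= fine (n E) by rewrite fine_ge0.
have splitR (n : {finite_measure set (measurableTypeR R) -> \bar R}) E :
    measurable E -> fine (n setT) = fine (n E) + fine (n (~` E)).
  move=> mE; rewrite -fineD ?fin_num_measure//; last exact: measurableC.
  by rewrite -measureU ?setUv//; [exact: measurableC | exact: setICr].
have total0 : fine (jp setT) = fine (jn setT).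
  apply/eqP; rewrite -subr_eq0 -decR//.
  by rewrite (tot m mD0) (tot pi piD0) /c divfK ?subrr// gt_eqF// (lt_le_trans _ pige).
pose Tk k := iter k (fun E => T @^-1` E : set (measurableTypeR R)) P.
have mTk k : measurable (Tk k).
  by elim: k => //= k IH; exact: mT.
(* By invariance the difference takes on [Tk k] the same value as on [P], the full mass of [jp];
   this maximum leaves no room for [jn]. *)
have jnTk k : jn (Tk k) = 0%E.
  have inv : fine (m (Tk k)) - c * fine (pi (Tk k)) = fine (m P) - c * fine (pi P).
    by elim: k => //= k <-; congr (fine _ - c * fine _); [exact: minv | exact: pinv].
  have := decR (Tk k) (mTk k); rewrite inv decR// jnP /= subr0 => e.
  have h1 := splitR jp P mP; rewrite jpP /= addr0 in h1.
  have h2 := mono jp (Tk k) setT (mTk k) measurableT (@subsetT _ _).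
  rewrite fm//; congr EFin; apply/eqP; rewrite eq_le nonneg andbT.
  by rewrite -(subKr (fine (jp (Tk k))) (fine (jn (Tk k)))) -e -h1 subr_le0.
pose U := \bigcup_k Tk k.
have mU : measurable U by exact: bigcupT_measurable.
have TU : T @^-1` U `<=` U by move=> x [k _ kx]; exists k.+1.
have jnU : fine (jn U) = 0.
  suff -> : jn U = 0%E by [].
  apply: measure_negligible => //; apply: negligible_bigcup => k.
  by apply/negligibleP; [exact: mTk | exact: jnTk].
have jpU : fine (jp (~` U)) = 0.
  apply/eqP; rewrite eq_le nonneg andbT.
  rewrite (le_trans (mono jp _ (~` P) _ _ _)) ?jpP//; try exact: measurableC.
  by apply: subsetC => x Px; exists 0%N.
have jp0 : fine (jp setT) = 0.
  have [U0|U0] := beta_map_ergodic b1 mU TU.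
    have := decR U mU; rewrite mnull// pinull//= mulr0 subr0 jnU subr0 => /esym e.
    by rewrite (splitR jp U mU) jpU e addr0.
  have mCU : measurable (~` U) by exact: measurableC.
  have := decR _ mCU; rewrite mnull// pinull//= mulr0 subr0 jpU sub0r => /esym/eqP.
  rewrite oppr_eq0 => /eqP e.
  by rewrite total0 (splitR jn U mU) jnU e addr0.
move=> E mE; have -> : parry b E = (fine (pi E))%:E by exact: (fm pi E).
rewrite (fm m)// -EFinM; congr EFin.
have := decR E mE.
have -> : fine (jp E) = 0.
  by apply/eqP; rewrite eq_le nonneg andbT -jp0 mono.
have -> : fine (jn E) = 0.
  by apply/eqP; rewrite eq_le nonneg andbT -jp0 total0 mono.
by rewrite subr0 => /eqP; rewrite subr_eq0 => /eqP.
Qed.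

End acim.


(** * Parry measures of different bases *)

Lemma common_lower_bound {R : realType} (f : nat -> R) (e0 : R) (N : nat) :
  0 < e0 -> (forall n, 0 < f n) ->
  exists e : R, [/\ 0 < e, e <= e0 & forall n, (n < N)%N -> e <= f n].
Proof.
move=> e00 f0; elim: N => [|N [e [ep ee0 ef]]]; first by exists e0.
exists (Num.min e (f N)); split.
- by rewrite lt_min ep f0.
- by rewrite ge_min ee0.
- move=> n; rewrite ltnS leq_eqVlt => /orP[/eqP ->|nN].
    by rewrite ge_min lexx orbT.
  by rewrite ge_min ef.
Qed.

Section parry_intervals.
Context {R : realType}.
Local Notation lambda := (@lebesgue_measure R).
Implicit Types (u w r e : R).

Lemma lebesgue_measure_icoI r u w : 0 <= u ->
  lambda (ico 0 r `&` ico u w) = (Num.max 0 (Num.min r w - u))%:E.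
Proof.
move=> u0; have -> : ico 0 r `&` ico u w = ico u (Num.min r w).
  apply/seteqP; split => x /=; rewrite !icoE lt_min.
    by move=> [/andP[_ ->] /andP[-> ->]].
  by move=> /andP[ux /andP[-> ->]]; rewrite ux (le_trans u0 ux).
have [um|mu] := leP u (Num.min r w).
  by rewrite lebesgue_measure_ico// max_r// subr_ge0.
rewrite max_l ?subr_le0 ?(ltW mu)// /ico lebesgue_measure_itv/= lte_fin.
by rewrite ltNge (ltW mu).
Qed.

Variable b : R.
Hypothesis b1 : 1 < b.

Let b0 : 0 < b. Proof. exact: lt_trans b1. Qed.

(** From index [N] on, each term is at most [b ^- n * e], and these bounds add up to a geometric
    tail. *)
Lemma parry_tail_le (E : set (measurableTypeR R)) (e : R) (N : nat) :
  measurable E -> 0 <= e -> (lambda E <= e%:E)%E ->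
  (parry b E <= \sum_(0 <= n < N) ((b ^- n)%:E * lambda (ico 0 (parry_orbit b n) `&` E))
     + (b ^- N * (b / (b - 1)) * e)%:E)%E.
Proof.
move=> mE e0 Ee.
rewrite parryE// (nneseries_split _ N); last by move=> n _; exact: parry_term_ge0.
rewrite add0n leeD2l// -nneseries_addn; last by move=> n; exact: parry_term_ge0.
rewrite mulrAC EFinM -(parry_series_weight b1) -nneseriesZl; last first.
  by move=> n _; rewrite lee_fin invr_ge0 exprn_ge0// ltW.
apply: lee_nneseries => [n _ _|n _]; first exact: parry_term_ge0.
have w0 : 0 <= b ^- (n + N) by rewrite invr_ge0 exprn_ge0// ltW.
apply: (@le_trans _ _ ((b ^- (n + N))%:E * e%:E)%E).
  apply: lee_wpmul2l; first by rewrite lee_fin.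
  apply: le_trans Ee; apply: le_measure; rewrite ?inE//.
  by apply: measurableI => //; exact: measurable_ico.
rewrite -!EFinM lee_fin exprD invfM le_eqVlt; apply/orP; left; apply/eqP; ring.
Qed.

Lemma parry_tail_cvg0 (c e : R) : 0 < e ->
  exists N, b ^- N * (b / (b - 1)) * c < e.
Proof.
move=> e0.
have cv : (b / (b - 1) * c) * b^-1 ^+ N @[N --> \oo] --> (0 : R).
  rewrite -[X in _ --> X](mulr0 (b / (b - 1) * c)); apply: cvgM; first exact: cvg_cst.
  by apply: cvg_expr; rewrite ger0_norm ?invr_ge0 ?(ltW b0)// invf_lt1.
move/cvgr0_norm_lt : cv => /(_ _ e0)[N _ /(_ N (leqnn N))] /= h.
exists N; apply: le_lt_trans h; apply: le_trans (ler_norm _).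
by rewrite exprVn mulrC mulrA [leLHS]mulrC mulrA.
Qed.

End parry_intervals.

Section distinct_parry_measures.
Context {R : realType}.
Local Notation lambda := (@lebesgue_measure R).
Variables b g cb cg : R.
Hypotheses (b1 : 1 < b) (irr : irrational b) (g1 : 1 < g).
Hypotheses (cb0 : 0 <= cb) (cg0 : 0 <= cg).
Hypothesis eqp : forall E : set (measurableTypeR R), measurable E ->
  (cb%:E * parry b E = cg%:E * parry g E)%E.

Let b0 : 0 < b. Proof. exact: lt_trans b1. Qed.
Let g0 : 0 < g. Proof. exact: lt_trans g1. Qed.

Let pb (u w : R) := fine (parry b (ico u w)).
Let pg (u w : R) := fine (parry g (ico u w)).

Let pbE u w : parry b (ico u w) = (pb u w)%:E.
Proof. by rewrite fineK// parry_fin//; exact: measurable_ico. Qed.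

Let pgE u w : parry g (ico u w) = (pg u w)%:E.
Proof. by rewrite fineK// parry_fin//; exact: measurable_ico. Qed.

Let eqpR u w : cb * pb u w = cg * pg u w.
Proof.
apply: EFin_inj; rewrite !EFinM -pbE -pgE; apply: eqp; exact: measurable_ico.
Qed.

Let y := fpart b.

Let parry_orbit1 : parry_orbit b 1 = y.
Proof. by rewrite /parry_orbit/= /beta_map mulr1. Qed.

Let y_gt0 : 0 < y. Proof. exact: fpart_gt0. Qed.
Let y_lt1 : y < 1. Proof. exact: fpart_lt1. Qed.

(** Compare [[0, e)] with [[1 - e, 1)] for small [e]. The ratio of masses is nearly at least
    [1 + b^-1] for [parry b] and at most [g / (g - 1)] for [parry g]; the latter is smaller exactly
    because [b < g - 1]. *)
Lemma parry_ratio : b + 1 < g -> cb = 0.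
Proof.
move=> bg; apply/eqP; rewrite eq_le cb0 andbT leNgt; apply/negP => cbp.
(* The first factor equals [1 + b^-1 - g / (g - 1)]; the second, the inverse of [g / (g - 1)], makes
   room for multiplying [eta] by that number. *)
have gap : 0 < (g - 1 - b) / (b * (g - 1)) * ((g - 1) / g).
  have gb : 0 < g - 1 - b by rewrite -addrA -opprD subr_gt0 addrC.
  have g1' : 0 < g - 1 by rewrite subr_gt0.
  by apply: mulr_gt0; apply: divr_gt0 => //; exact: mulr_gt0.
have [N etaN] := parry_tail_cvg0 b1 1 gap.
set eta := b ^- N * _ * _ in etaN.
have orb n : 0 < 1 - parry_orbit b n.+1.
  by rewrite subr_gt0 parry_orbitS fpart_lt1.
(* [e <= y] puts [[0, e)] under the terms [0] and [1]; the other bounds keep the terms [1] to [N]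
   away from [[1 - e, 1)]. *)
have [e [e0 ey eN]] := common_lower_bound N y_gt0 orb.
have e1 : e <= 1 by rewrite (le_trans ey)// ltW.
have me u w : measurable (@ico R u w) by exact: measurable_ico.
have lo_b : e * (1 + b^-1) <= pb 0 e.
  rewrite -lee_fin -pbE parryE//.
  apply: le_trans (nneseries_lim_ge 2 _); last by move=> n _ _; exact: parry_term_ge0.
  rewrite big_nat_recr// big_nat1/= !lebesgue_measure_icoI//.
  rewrite /beta_map mulr1 -/y !subr0 (min_idPr e1) (min_idPr ey) max_r ?(ltW e0)//.
  by rewrite -!EFinM -EFinD lee_fin expr0 invr1 mul1r expr1 mulrDr mulr1 mulrC.
have hi_g : pg 0 e <= g / (g - 1) * e.
  rewrite -lee_fin -pgE; apply: parry_le => //; first exact: ltW.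
  move=> n; rewrite lebesgue_measure_icoI// lee_fin subr0 ge_max (ltW e0)/=.
  by rewrite ge_min lexx orbT.
have lo_g : e <= pg (1 - e) 1.
  rewrite -lee_fin -pgE; apply: le_trans (parry_ge g1 (me _ _)).
  rewrite lebesgue_measure_icoI ?subr_ge0//.
  by rewrite minxx opprB addrCA subrr addr0 lee_fin le_max lexx orbT.
have hi_b : pb (1 - e) 1 <= e * (1 + eta).
  rewrite -lee_fin -pbE.
  apply: le_trans (parry_tail_le b1 N.+1 (me _ _) (ltW e0) _) _.
    by rewrite lebesgue_measure_ico ?gerBl ?(ltW e0)// opprB addrCA subrr addr0.
  rewrite big_nat_recl//= big1_seq ?addr0; last first.
    move=> n /=; rewrite mem_index_iota => /andP[_ nN].
    rewrite lebesgue_measure_icoI ?subr_ge0// max_l ?mule0//.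
    rewrite subr_le0 ge_min; apply/orP; left.
    by have := eN n nN; rewrite lerBrDl addrC -lerBrDl.
  rewrite lebesgue_measure_icoI ?subr_ge0// minxx opprB addrCA subrr addr0.
  rewrite expr0 invr1 mul1e (max_r (ltW e0)) -EFinD lee_fin.
  rewrite mulrDr mulr1 lerD2l /eta mulr1 mulrC ler_wpM2l ?(ltW e0)//.
  rewrite ler_wpM2r ?divr_ge0 ?subr_ge0 ?(ltW b0) ?(ltW b1)//.
  rewrite lef_pV2 ?posrE ?exprn_gt0// exprS ler_peMl ?exprn_ge0 ?(ltW b0)//.
  exact: ltW.
have h1 : cb * (e * (1 + b^-1)) <= cg * (g / (g - 1) * e).
  by apply: le_trans (ler_wpM2l cb0 lo_b) _; rewrite eqpR ler_wpM2l.
have h2 : cg * e <= cb * (e * (1 + eta)).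
  by apply: le_trans (ler_wpM2l cg0 lo_g) _; rewrite -eqpR ler_wpM2l.
have gg : 0 < g / (g - 1) by rewrite divr_gt0// subr_gt0.
have h3 : cb * (e * (1 + b^-1)) <= cb * (e * (1 + eta)) * (g / (g - 1)).
  apply: le_trans h1 _; rewrite mulrCA mulrA [leRHS]mulrC -mulrA ler_pM2l//.
have h4 : 1 + b^-1 <= (1 + eta) * (g / (g - 1)).
  have ce : 0 < cb * e by exact: mulr_gt0.
  by rewrite -(ler_pM2l ce) [leRHS]mulrA -!mulrA; move: h3; rewrite -!mulrA.
have h5 : eta * (g / (g - 1)) < (g - 1 - b) / (b * (g - 1)).
  by rewrite -ltr_pdivlMr// invf_div.
have : (g - 1 - b) / (b * (g - 1)) = 1 + b^-1 - g / (g - 1).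
  by field; rewrite !gt_eqF// subr_gt0.
move: h4 h5; rewrite mulrDl mul1r; lra.
Qed.

(* The density of [parry b] jumps at [fpart b], that of [parry g] only at the
   rational points of the orbit of [1]. *)
Lemma parry_jump : rational g -> cb = 0.
Proof.
move=> rg; apply/eqP; rewrite eq_le cb0 andbT leNgt; apply/negP => cbp.
have ratorb n : rational (parry_orbit g n).
  elim: n => [|n IH]; first by exists 1 => //; rewrite rmorph1.
  by rewrite parry_orbitS; exact: rational_beta_map.
have irry : irrational y.
  case=> r _ rE; apply: irr; exists (r + (Num.floor b)%:~R) => //.
  have -> : ratr (r + (Num.floor b)%:~R) = ratr r + (Num.floor b)%:~R :> R.
    by rewrite rmorphD rmorph_int.
  by rewrite rE /y /fpart subrK.
have orb n : 0 < `|parry_orbit g n - y|.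
  by rewrite normr_gt0 subr_eq0; apply/eqP => e; apply: irry; rewrite -e.
(* [cb / b] is the jump at [y] of the density of [cb * parry b]; [N] makes the tail of
   [cg * parry g] smaller than it. *)
have gap : 0 < cb / b by exact: divr_gt0.
have [N tailN] := parry_tail_cvg0 g1 cg gap.
have m0 : 0 < Num.min y (1 - y) by rewrite lt_min y_gt0 subr_gt0.
have [e [e0 ey eN]] := common_lower_bound N m0 orb.
move: ey; rewrite le_min => /andP[ey e1y].
have me u w : measurable (@ico R u w) by exact: measurable_ico.
have ye0 : 0 <= y - e by rewrite subr_ge0.
(* Lengths of [[0, r)] within the windows of width [e] left and right of [y]: never larger on the
   right, and equal if [r] is at distance at least [e] from [y]. *)
pose hl r := Num.max 0 (Num.min r y - (y - e)).
pose hr r := Num.max 0 (Num.min r (y + e) - y).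
have hl0 r : 0 <= hl r by rewrite le_max lexx.
have hr0 r : 0 <= hr r by rewrite le_max lexx.
have lamL r : lambda (ico 0 r `&` ico (y - e) y) = (hl r)%:E.
  exact: lebesgue_measure_icoI.
have lamR r : lambda (ico 0 r `&` ico y (y + e)) = (hr r)%:E.
  by apply: lebesgue_measure_icoI; exact: ltW.
have hrl r : hr r <= hl r.
  rewrite /hl /hr; case: (leP r y) => ry.
    rewrite max_l ?le_max ?lexx// subr_le0 ge_min ry//.
  rewrite [leRHS]max_r ?subr_ge0 ?gerBl ?(ltW e0)// subKr ge_max (ltW e0)/=.
  by rewrite lerBlDl ge_min lexx orbT.
have hlr r : e <= `|r - y| -> hl r = hr r.
  rewrite /hl /hr; case: (leP r y) => ry.
    rewrite ler0_norm ?subr_le0// opprB => h.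
    by rewrite !max_l// ?subr_le0 ?ge_min ?ry//; lra.
  rewrite gtr0_norm ?subr_gt0// => h.
  rewrite (@min_r _ _ r (y + e)); last by lra.
  by rewrite subKr addrC addKr.
have wb n : (0%:E <= (b ^- n)%:E :> \bar R)%E by rewrite lee_fin invr_ge0 exprn_ge0// ltW.
(* The term [n = 1], of orbit point [y], fills the left window and misses the right one,
   contributing [e / b]; no other term favours the right. *)
have jump_b : pb y (y + e) + e / b <= pb (y - e) y.
  rewrite -lee_fin EFinD -!pbE !parryE//.
  rewrite (nneseriesD1 (n := 1%N))//; last by move=> n _; exact: parry_term_ge0.
  rewrite [leRHS](nneseriesD1 (n := 1%N))//; last by move=> n _; exact: parry_term_ge0.
  have hry : hr y = 0 by rewrite /hr min_l ?lerDl ?(ltW e0)// subrr maxxx.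
  have hly : hl y = e by rewrite /hl minxx subKr max_r// ltW.
  rewrite lamL lamR !parry_orbit1 hry hly mule0 add0e addeC leeD//.
    by rewrite expr1 -EFinM lee_fin mulrC.
  apply: lee_nneseries => [n _ _|n _]; first exact: parry_term_ge0.
  by apply: lee_wpmul2l => //; rewrite lamL lamR lee_fin.
(* The first [N] orbit points of [g] are at distance at least [e] from [y], so only the tail can
   distinguish the windows. *)
have flat_g : pg (y - e) y <= pg y (y + e) + g ^- N * (g / (g - 1)) * e.
  rewrite -lee_fin EFinD -!pgE.
  apply: le_trans (parry_tail_le g1 N (me _ _) (ltW e0) _) _.
    by rewrite lebesgue_measure_ico ?gerBl ?(ltW e0)// subKr.
  apply: leeD2r; rewrite parryE//.
  apply: le_trans (nneseries_lim_ge N _); last by move=> n _ _; exact: parry_term_ge0.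
  rewrite le_eqVlt; apply/orP; left; apply/eqP; apply: eq_big_nat => n /andP[_ nN].
  by rewrite lamL lamR hlr// eN.
have h1 := ler_wpM2l cb0 jump_b.
have h2 := ler_wpM2l cg0 flat_g.
have h3 := eqpR (y - e) y.
have h4 := eqpR y (y + e).
have h5 : cb * (e / b) <= cg * (g ^- N * (g / (g - 1)) * e).
  by rewrite -(lerD2l (cb * pb y (y + e))) -mulrDr (le_trans h1)// h3 h4 -mulrDr.
have h6 : cb / b * e <= g ^- N * (g / (g - 1)) * cg * e.
  move: h5; rewrite mulrCA [e * _]mulrC [X in _ <= X -> _]mulrC.
  by rewrite -[X in _ <= X -> _]mulrA [e * _]mulrC mulrA.
move: h6; rewrite ler_pM2r// leNgt => /negP; exact.
Qed.

End distinct_parry_measures.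


(** * Vanishing of the common invariant measure off zero *)

Section common_invariant.
Context d (X : measurableType d) {R : realType}.
Variable mu : {finite_measure set X -> \bar R}.
Variables (v : X -> R) (B G : X -> X) (b g : R) (k p q : nat).
Hypotheses (mv : measurable_fun setT v) (v01 : forall x, 0 <= v x < 1).
Hypotheses (Bmu : preserves mu B) (Gmu : preserves mu G).
Hypotheses (vB : forall x, v (B x) = beta_map b (v x)).
Hypotheses (vG : forall x, v (G x) = beta_map g (v x)).
Hypotheses (b1 : 1 < b) (irr : irrational b) (g1 : 1 < g) (q0 : (0 < q)%N).
Hypothesis gE : g = k%:R * b + p%:R / q%:R.
Hypothesis kc : 1 < k%:R + p%:R / q%:R :> R.
Hypothesis far : b + 1 < g \/ rational g.

Let V := [set x | 0 < v x].

Let mV : measurable V.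
Proof. by rewrite /V -[X in measurable X]setTI -preimage_itvoy; exact: mv. Qed.

Let mv' : measurable_fun setT (v : X -> measurableTypeR R).
Proof. exact: mv. Qed.

Let mpre (E : set (measurableTypeR R)) : measurable E -> measurable (v @^-1` E).
Proof. by move=> mE; rewrite -[X in measurable X]setTI; exact: mv'. Qed.

(** Since [beta_map c] fixes [0], [V] contains its preimage, and having the same finite measure it
    differs from it by a null set; so restricting [mu] to [V] keeps it invariant. *)
Let restricted_invariant (T : X -> X) (c : R) (A : set X) :
  preserves mu T -> (forall x, v (T x) = beta_map c (v x)) -> measurable A ->
  mu (T @^-1` A `&` V) = mu (A `&` V).
Proof.
move=> [mT muT] vT mA.
have mpT E : measurable E -> measurable (T @^-1` E).
  by move=> mE; rewrite -[X in measurable X]setTI; exact: mT.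
have TV : T @^-1` V `<=` V.
  move=> x; rewrite /V /= vT lt_def => /andP[vT0 _].
  have /andP[vx0 _] := v01 x; rewrite lt_def vx0 andbT.
  by apply: contra vT0 => /eqP ->; rewrite /beta_map mulr0 fpart_id// lexx ltr01.
have null : mu (V `\` T @^-1` V) = 0%E.
  rewrite measureD//; last 2 first.
  - exact: mpT.
  - by rewrite ltey_eq fin_num_measure.
  rewrite (_ : V `&` T @^-1` V = T @^-1` V); last exact/setIidPr.
  by rewrite [X in (_ - X)%E](muT V mV) subee// fin_num_measure.
transitivity (mu (T @^-1` (A `&` V))); last by rewrite muT//; exact: measurableI.
have mTA := mpT A mA; have mTV := mpT V mV.
rewrite (measureDI mu (measurableI _ _ mTA mV) mTV).
rewrite [X in (X + _)%E](_ : _ = 0%E) ?add0e.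
  by congr (mu _); rewrite preimage_setI -setIA [V `&` _]setIidr.
apply: subset_measure0 null.
- by apply: measurableD => //; exact: measurableI.
- exact: measurableD.
by move=> x [[_ Vx] nTV].
Qed.

(** The image under [v] of [mu] restricted to [V] is absolutely continuous and invariant under both
    maps, hence a multiple of both Parry measures; [far] forces the factor to be zero. *)
Lemma common_invariant_trivial : mu [set x | 0 < v x] = 0%E.
Proof.
pose m : {measure set (measurableTypeR R) -> \bar R} :=
  pushforward (mrestr mu mV) (v : X -> measurableTypeR R).
have mE E : m mv' E = mu (v @^-1` E `&` V) by [].
have mfin : fin_num_fun (m mv').
  by move=> E mE'; rewrite mE fin_num_measure//; apply: measurableI => //; exact: mpre.
pose mf : {finite_measure set (measurableTypeR R) -> \bar R} :=
  HB.pack (Measure.sort (m mv')) (Measure_isFinite.Build _ _ _ (m mv') mfin).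
have mfE E : mf E = mu (v @^-1` E `&` V) by [].
have mD : measurable (@ico R 0 1) by exact: measurable_ico.
have mf0 : mf (~` ico 0 1) = 0%E.
  rewrite mfE (_ : _ `&` _ = set0) ?measure0//.
  by apply/seteqP; split => // x [+ _] => /=; rewrite icoE v01.
have mfac (E : set (measurableTypeR R)) :
    measurable E -> lebesgue_measure E = 0%E -> mf E = 0%E.
  move=> mE' E0; rewrite mfE.
  exact: (common_invariant_null mv v01 Bmu Gmu vB vG b1 irr g1 q0 gE kc).
have inv (T : X -> X) (c : R) : preserves mu T ->
    (forall x, v (T x) = beta_map c (v x)) ->
    forall E : set (measurableTypeR R), measurable E -> mf (beta_map c @^-1` E) = mf E.
  move=> Tmu vT E mE'; rewrite !mfE -(restricted_invariant Tmu vT (mpre mE')).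
  by congr (mu (_ `&` _)); apply/seteqP; split => x /=; rewrite vT.
have [cb cb0 cbP] := acim_unique b1 mf0 mfac (inv _ _ Bmu vB).
have [cg cg0 cgP] := acim_unique g1 mf0 mfac (inv _ _ Gmu vG).
have cb00 : cb = 0.
  have eqp (E : set (measurableTypeR R)) : measurable E ->
      (cb%:E * parry b E = cg%:E * parry g E)%E.
    by move=> mE'; rewrite -cbP// cgP.
  have [far1|rat] := far; first exact: (parry_ratio b1 irr g1 cb0 cg0 eqp).
  exact: (parry_jump b1 irr g1 cb0 cg0 eqp).
have := cbP setT measurableT; rewrite cb00 mul0e mfE.
by rewrite preimage_setT setTI.
Qed.

End common_invariant.


(** * The interval [0, 1) as a measurable space *)

Section borel_ico.
Context {R : realType}.
Local Notation v := (val : borel_ico R -> R).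

Lemma open_ico_preimage (O : set (unit_ico R)) : open O ->
  exists2 U : set R, open U & v @^-1` U = O.
Proof. by case=> U oU <-; exists U. Qed.

Lemma measurable_ico_val : measurable_fun setT v.
Proof.
apply: (measurability (@RGenOpens.G R)); first exact: RGenOpens.measurableE.
move=> _ [_ [x [y ->]] <-]; rewrite setTI; apply: sub_sigma_algebra.
exists `]x, y[%classic => //; exact: interval_open.
Qed.

Lemma ico_val_itv (x : borel_ico R) : 0 <= v x < 1.
Proof. by have := set_mem (valP x); rewrite /= in_itv. Qed.

Lemma beta_transform_val (b : R) x : v (beta_transform b x) = beta_map b (v x).
Proof. by []. Qed.

Lemma measurable_beta_transform (b : R) : measurable_fun setT (@beta_transform R b).
Proof.
apply: (@measurability _ _ (borel_ico R) (borel_ico R) setT _ (@open (unit_ico R))) => //.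
move=> _ [W /open_ico_preimage[U oU <-] <-].
rewrite setTI.
have -> : beta_transform b @^-1` (v @^-1` U) = v @^-1` (beta_map b @^-1` U) by [].
rewrite -[X in measurable X]setTI; apply: measurable_ico_val => //.
by apply: measurable_beta_map_preimage; exact: open_measurable.
Qed.

Lemma beta_transform_ico0 (b : R) : beta_transform b (ico0 R) = ico0 R.
Proof.
by apply: val_inj; rewrite beta_transform_val /= /beta_map mulr0 fpart_id// lexx ltr01.
Qed.

Lemma dirac0_only_common_invariantP (b g : R) (k p q : nat) :
  1 < b -> irrational b -> 1 < g -> (0 < q)%N ->
  g = k%:R * b + p%:R / q%:R -> 1 < k%:R + p%:R / q%:R :> R ->
  b + 1 < g \/ rational g -> dirac0_only_common_invariant b g.
Proof.
move=> b1 irr g1 q0 gE kc far mu; split; last first.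
  move=> mu0.
  have inv c : invariant_measure mu (beta_transform c).
    move=> E mE; rewrite /pushforward mu0.
      rewrite mu0// !diracE; congr ((nat_of_bool _)%:R%:E).
      by apply/idP/idP => /set_mem h; apply/mem_set; move: h;
        rewrite /preimage/= beta_transform_ico0.
    by rewrite -[X in measurable X]setTI; exact: measurable_beta_transform.
  by split.
move=> [muB muG].
pose V := [set x : borel_ico R | 0 < v x].
have mV : measurable V.
  by rewrite /V -[X in measurable X]setTI -preimage_itvoy; exact: measurable_ico_val.
have V0 : mu V = 0%E.
  have pB : preserves mu (beta_transform b) by split => //; exact: measurable_beta_transform.
  have pG : preserves mu (beta_transform g) by split => //; exact: measurable_beta_transform.
  exact: (common_invariant_trivial measurable_ico_val ico_val_itv pB pG
    (beta_transform_val b) (beta_transform_val g) b1 irr g1 q0 gE kc far).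
have nV x : ~ V x -> x = ico0 R.
  move=> /negP; rewrite -leNgt => x0; apply: val_inj => /=.
  by apply/eqP; rewrite eq_le x0; case/andP: (ico_val_itv x).
(* A set that misses [0] lies in the null set [V]; one that contains [0] has its complement in [V],
   hence full mass. *)
move=> E mE; rewrite diracE.
have [E0|E0] := boolP (ico0 R \in E).
  have : mu (~` E) = 0%E.
    apply: subset_measure0 V0 => //; first exact: measurableC.
    move=> x nEx; apply: contrapT => /nV xE.
    by apply: nEx; rewrite xE; exact: set_mem.
  move=> CE0; rewrite -[E]setCK probability_setC ?CE0 ?sube0//; exact: measurableC.
rewrite /=; apply: subset_measure0 V0 => // x Ex; apply: contrapT => /nV xE.
by move: E0; rewrite -xE mem_set.
Qed.

Lemma rational_nonneg (c : R) : rational c -> 0 <= c ->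
  exists p q : nat, (0 < q)%N /\ c = p%:R / q%:R.
Proof.
case=> r _ <-; rewrite ler0q => r0.
exists `|numq r|%N, `|denq r|%N; split; first by rewrite absz_gt0 denq_neq0.
rewrite !natr_absz !ger0_norm ?numq_ge0 ?denq_ge0//.
Qed.

End borel_ico.

Theorem corollary1p5 (R : realType) :
  (forall (beta : R) (k : int) (c : R),
     1 < beta -> irrational beta -> (2 <= k)%R -> rational c -> 0 <= c ->
     dirac0_only_common_invariant beta (k%:~R * beta + c))
  /\
  (forall beta gamma : R,
     1 < beta -> irrational beta -> 1 < gamma -> rational gamma ->
     dirac0_only_common_invariant beta gamma).
Proof.
split=> [b k c b1 irr k2 rc c0|b g b1 irr g1 rg].
  have [p [q [q0 cE]]] := rational_nonneg rc c0.
  have k2R : 2 <= k%:~R :> R by rewrite (ler_int _ 2).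
  have kE : k%:~R = `|k|%N%:R :> R by rewrite natr_absz ger0_norm//; lia.
  (* [b + 1 < 2 * b] because [b > 1], so [k >= 2] brings this case under the ratio criterion. *)
  have gb : b + 1 < k%:~R * b + c.
    by have : 2 * b <= k%:~R * b; [rewrite ler_pM2r//; lra | lra].
  apply: (@dirac0_only_common_invariantP R b _ `|k|%N p q) => //.
  - by lra.
  - by rewrite -kE -cE.
  - by rewrite -kE -cE; lra.
  - by left.
have [p [q [q0 gE]]] := rational_nonneg rg (ltW (lt_trans ltr01 g1)).
apply: (@dirac0_only_common_invariantP R b g 0 p q) => //.
- by rewrite mul0r add0r.
- by rewrite add0r -gE.
- by right.
Qed.
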